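(* Let $c,b_0,b_1,a_0,a_1\in\mathbb{R}$ with $c\,a_1 b_1\le 0$ and $c\,a_1\neq 0$, and let $B(z)=b_0+b_1z$, $A(z)=a_0+a_1z$. Define polynomials $P_m(z)$, $m\ge 0$, by $$\sum_{m=0}^\infty P_m(z)t^m=\frac{1}{1+ct+B(z)t^2+A(z)t^3}.$$ Put $a:=\dfrac{b_0}{c^2}-\dfrac{b_1a_0}{c^2a_1}$ and $b:=-\dfrac{b_1c}{a_1}$. Then all zeros of $P_m(z)$ are real for every $m\in\mathbb{N}$ if and only if $$1+a+b\ge 0\qquad\text{and}\qquad 9-27a+b\ge 0.$$
   Context: Equivalently, $P_0\equiv 1$, $P_{-k}\equiv 0$ for $k\ge1$, and $P_m(z)+cP_{m-1}(z)+B(z)P_{m-2}(z)+A(z)P_{m-3}(z)=0$ for $m\ge1$. *)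

(* Defs.v *)
From HB Require Import structures.
From mathcomp Require Import all_boot all_order all_algebra.
Set Implicit Arguments. Unset Strict Implicit. Unset Printing Implicit Defensive.
Import Order.TTheory GRing.Theory Num.Theory.
Local Open Scope ring_scope.

(* Triple (P_m, P_{m+1}, P_{m+2}) via the recurrence
   P_m + c P_{m-1} + B P_{m-2} + A P_{m-3} = 0, P_0 = 1, P_{-k} = 0. *)
Fixpoint Ptriple (R : nzRingType) (c : R) (B A : {poly R}) (m : nat)
  : {poly R} * {poly R} * {poly R} :=
  match m with
  | 0%N => (1, - c%:P, c%:P * c%:P - B)
  | m'.+1 =>
      let: (p0, p1, p2) := Ptriple c B A m' in
      (p1, p2, - (c%:P * p2) - B * p1 - A * p0)
  end.

(* P_m(z): coefficient of t^m in 1/(1 + c t + B(z) t^2 + A(z) t^3). *)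
Definition Pm (R : nzRingType) (c : R) (B A : {poly R}) (m : nat) : {poly R} :=
  (Ptriple c B A m).1.1.

Definition real_rooted (R : rcfType) (p : {poly R}) : Prop :=
  exists s : seq R, p = lead_coef p *: \prod_(x <- s) ('X - x%:P).

(* Main.v *)
Require Import Defs.
From HB Require Import structures.
From mathcomp Require Import all_boot all_order all_algebra.
From mathcomp Require Import polyrcf complex.
From mathcomp Require Import zify ring lra.
Set Implicit Arguments. Unset Strict Implicit. Unset Printing Implicit Defensive.
Import Order.TTheory GRing.Theory Num.Theory.
Local Open Scope ring_scope.

(** An affine change of z turns the denominator into 1 + t + (a - b w) t^2 + w t^3
with b >= 0, and P_m(w) into the complete homogeneous symmetric polynomial h_m of the
roots of x^3 + x^2 + (a - b w) x + w.  Up to a factor, these roots are e^(it), e^(-it)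
and z, and then, for u = 2 cos t, the pair (u, z) satisfies
a (z + u)^3 = (z + u) (1 + u z) + b z.

The two inequalities imply that for every 0 < u < 2 (for 1 < u < 2 if b = 0) this
cubic has a root z in ]-1, 1[.  At u = 2 cos (k pi / (m + 2)) the sign of h_m is then
the sign of (-1)^(k + 1) + z^(m + 2), hence alternates with k; the points w are
monotone in u, so P_m has all its zeros, but possibly one, on the real line.

If one of the inequalities fails, the cubic in z has for some 0 < u < 2 a nonreal root
with |z| < 1, so at some nonreal w two roots x, x' of equal modulus dominate, and x'
and x have different logarithmic derivatives with respect to w.  Then
P_m'' P_m - P_m'^2 is of order m^2 |x|^(2 m) at w, while for a real-rooted P_m it is at
most m |P_m|^2 / (Im w)^2. *)

(** * Chebyshev nodes *)

(* [cheb (2 cos t) n = sin (n t) / sin t]. *)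
Fixpoint cheb (R : comNzRingType) (u : R) (n : nat) {struct n} : R :=
  match n with
  | 0 => 0
  | n'.+1 => if n' is n''.+1 then u * cheb u n' - cheb u n'' else 1
  end.

(* [cheb2cos (2 cos t) n = 2 cos (n t)]. *)
Definition cheb2cos (R : comNzRingType) (u : R) (n : nat) : R :=
  2 * cheb u n.+1 - u * cheb u n.

Section ChebRing.
Variable R : comNzRingType.
Implicit Type u : R.

Lemma chebSS u n : cheb u n.+2 = u * cheb u n.+1 - cheb u n.
Proof. by []. Qed.

Lemma cheb_2 u : cheb u 2 = u.
Proof. by rewrite /= mulr1 subr0. Qed.

Lemma cheb_3 u : cheb u 3 = u ^+ 2 - 1.
Proof. by rewrite chebSS cheb_2. Qed.

Lemma cheb2cosSS u n : cheb2cos u n.+2 = u * cheb2cos u n.+1 - cheb2cos u n.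
Proof. by rewrite /cheb2cos !chebSS; ring. Qed.

(** For u = 2 cos t this is sin (n + 2k)t + sin nt = 2 cos kt sin (n + k)t, proved from the
    recurrence alone and so valid in any commutative ring. *)
Lemma cheb_add_sub u k n :
  cheb u (n + k + k) + cheb u n = cheb2cos u k * cheb u (n + k).
Proof.
elim/ltn_ind: k n => -[|[|k]] IH n.
- by rewrite !addn0 /cheb2cos /=; ring.
- by rewrite !addn1 chebSS /cheb2cos /=; ring.
have := IH k.+1 (ltnSn _) n.+1; have := IH k (ltnW (ltnSn _)) n.+2.
rewrite cheb2cosSS.
have -> : (n + k.+2 + k.+2 = (n + k + k).+4)%N by lia.
have -> : (n.+2 + k + k = (n + k + k).+2)%N by lia.
have -> : (n.+1 + k.+1 + k.+1 = (n + k + k).+3)%N by lia.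
have -> : (n + k.+2 = (n + k).+2)%N by lia.
have -> : (n.+2 + k = (n + k).+2)%N by lia.
have -> : (n.+1 + k.+1 = (n + k).+2)%N by lia.
move=> e1 e2; rewrite [RHS](_ : _ = u * (cheb2cos u k.+1 * cheb u (n + k).+2)
  - cheb2cos u k * cheb u (n + k).+2); last by ring.
by rewrite -e1 -e2 (chebSS u (n + k + k).+2) (chebSS u n); ring.
Qed.

Lemma cheb_mul u j k : cheb u (j * k) = cheb u k * cheb (cheb2cos u k) j.
Proof.
elim/ltn_ind: j => -[|[|j]] IH; first by rewrite mul0n mulr0.
  by rewrite mul1n mulr1.
have := cheb_add_sub u k (j * k).
have -> : (j * k + k + k = j.+2 * k)%N by rewrite !mulSn; lia.
have -> : (j * k + k = j.+1 * k)%N by rewrite !mulSn; lia.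
rewrite (IH j.+1) // => /esym/eqP; rewrite -subr_eq => /eqP <-.
by rewrite (IH j) ?ltnS ?leqnSn // chebSS; ring.
Qed.

(** A quadratic form preserved by the recurrence: next to a zero the sequence is 1 or -1. *)
Lemma cheb_det u n : cheb u n.+1 ^+ 2 - u * cheb u n.+1 * cheb u n + cheb u n ^+ 2 = 1.
Proof. elim: n => [|n IH]; first by rewrite /=; ring.
by rewrite chebSS -[RHS]IH; ring. Qed.

Lemma cheb2cosS u n :
  2 * cheb2cos u n.+1 = u * cheb2cos u n - (4 - u ^+ 2) * cheb u n.
Proof. by rewrite /cheb2cos chebSS; ring. Qed.

Lemma cheb_at2 n : cheb (2 : R) n = n%:R.
Proof.
elim/ltn_ind: n => -[|[|n]] IH //.
by rewrite chebSS !IH ?ltnS ?leqnSn // -!natr1; ring.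
Qed.

Lemma horner_cheb (x : R) n : (cheb 'X n).[x] = cheb x n.
Proof.
elim/ltn_ind: n => -[|[|n]] IH; rewrite /= ?hornerE // -/(cheb 'X n.+1) -/(cheb x n.+1).
by rewrite !IH ?ltnS ?leqnSn.
Qed.

(** For u = 2 cos t the hypotheses make (N + 1) t an odd multiple of pi, so this is sin (x + pi) = -
    sin x; likewise [cheb_refl] is sin (pi - x) = sin x. *)
Lemma cheb_shift u N : cheb u N.+1 = 0 -> cheb u N = 1 ->
  forall n, cheb u (N.+1 + n) = - cheb u n.
Proof.
move=> h0 h1; elim/ltn_ind => -[|[|n]] IH; first by rewrite addn0 h0 oppr0.
  by rewrite addn1 chebSS h0 h1 mulr0 sub0r.
have := IH n (ltnW (ltnSn _)); have := IH n.+1 (ltnSn _); rewrite !addnS => e1 e2.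
by rewrite chebSS e1 e2 (chebSS u n); ring.
Qed.

Lemma cheb_refl u N : cheb u N.+1 = 0 -> cheb u N = 1 ->
  forall n, (n <= N.+1)%N -> cheb u (N.+1 - n) = cheb u n.
Proof.
move=> h0 h1; elim/ltn_ind => -[|[|n]] IH le; rewrite ?subn0 // ?subn1 //.
have := IH n (ltnW (ltnSn _)) (ltnW (ltnW le)); have := IH n.+1 (ltnSn _) (ltnW le).
have [m ->] : exists m, N = (m + n).+1 by exists (N - n.+1)%N; lia.
have -> : ((m + n).+2 - n.+1 = m.+1)%N by lia.
have -> : ((m + n).+2 - n = m.+2)%N by lia.
have -> : ((m + n).+2 - n.+2 = m)%N by lia.
by rewrite !chebSS => e1 e2; rewrite -e1 -e2; ring.
Qed.

End ChebRing.

Section ChebNodes.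
Variable R : rcfType.

Lemma largest_root (p : {poly R}) (a b : R) : a < b -> p.[a] < 0 -> 0 < p.[b] ->
  exists c, [/\ a < c, c < b, p.[c] = 0 & forall y, c < y -> y <= b -> 0 < p.[y]].
Proof.
move=> ab pa pb.
have p0 : p != 0 by apply: contraTneq pb => ->; rewrite horner0 ltxx.
have pab : p.[a] * p.[b] < 0 by rewrite nmulr_rlt0.
have [c0 c0i rc0] := poly_ivtoo (ltW ab) pab.
(* [prev_root] falls back to [a] when the interval has no root; the root [c0] excludes this. *)
have [c hc rc] : exists2 c, c = prev_root p a b & c != a.
  exists (prev_root p a b) => //; apply/eqP => h.
  have := @prev_noroot _ p a b c0; rewrite h c0i => /(_ isT).
  by rewrite rc0.
have cin := prev_root_in p a b; have clt := prev_root_lt ab p0.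
rewrite -hc (min_l (ltW ab)) in_itv /= in cin; rewrite -hc in clt.
have pc : p.[c] = 0.
  rewrite hc; move: rc; rewrite hc; case: prev_rootP => // [->|d _ ->].
    by rewrite horner0.
  by rewrite (min_l (ltW ab)) eqxx.
exists c; split=> //; first by rewrite lt_neqAle eq_sym rc; case/andP: cin.
move=> y cy; rewrite le_eqVlt => /predU1P[-> //|yb].
rewrite ltNge; apply/negP => py.
have [|z zi rz] := poly_ivt (p := p) (ltW yb); first by rewrite py ltW.
have zb : z != b by apply: contraTneq rz => ->; rewrite rootE gt_eqF.
have := @prev_noroot _ p a b z; rewrite -hc in_itv /= rz => /implyP.
by move: zi; rewrite [z < b]lt_neqAle zb => /andP[/(lt_le_trans cy) -> ->].
Qed.

(** Here u is 2 cos (pi / (N + 2)), built as the largest zero below 2. At that zero the next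
    polynomial equals [- cheb u N.+1 < 0], while at 2 it equals N + 3, so its largest zero lies
    between u and 2. Positivity to the right of u carries the induction. *)
Lemma cheb_base (N : nat) : exists u : R,
  [/\ u < 2, cheb u N.+2 = 0, forall j, (0 < j < N.+2)%N -> 0 < cheb u j
   & forall x, u < x -> x <= 2 -> forall j, (0 < j <= N.+2)%N -> 0 < cheb x j].
Proof.
elim: N => [|N [u [u2 uN uj ux]]].
  exists 0; split=> [||[|[|j]]//|x x0 x2 [|[|[|j]]]//]; rewrite ?ltr0n //= ?subr0.
  - by rewrite mul0r.
  - by rewrite mulr1.
have [||| c [uc c2 pc cx]] := @largest_root (cheb 'X N.+3) u 2 => //.
- by rewrite horner_cheb chebSS uN mulr0 sub0r oppr_lt0 uj ?leqnn.
- by rewrite horner_cheb cheb_at2 ltr0n.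
move: pc; rewrite horner_cheb => pc.
exists c; split=> //.
- by move=> j /andP[j0]; rewrite ltnS => jN; apply: ux; rewrite ?(ltW c2) ?j0.
- move=> x xc x2 j /andP[j0]; rewrite leq_eqVlt => /predU1P[->|jN].
    by rewrite -horner_cheb; apply: cx.
  by apply: ux => //; [apply: lt_trans xc | rewrite j0].
Qed.

(* The nodes are [2 cos (k pi / (m + 2))]. *)
Lemma cheb_nodes (m : nat) : exists c : nat -> R,
  [/\ forall k, (0 < k)%N -> (k * 2 < m.+2)%N -> 0 < c k < 2,
      forall k, (0 < k)%N -> (k * 3 < m.+2)%N -> 1 < c k,
      forall k, (0 < k)%N -> (k.+1 * 2 < m.+2)%N -> c k.+1 < c k &
      forall k, (0 < k)%N -> (k * 2 < m.+2)%N ->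
        cheb (c k) m.+2 = 0 /\ cheb (c k) m.+1 = (-1) ^+ k.+1].
Proof.
have [u [u2 uN uj _]] := cheb_base m; exists (cheb2cos u).
have u0 : 0 <= u.
  case: m uN uj => [|m] uN uj; first by move: uN; rewrite /= mulr1 subr0 => ->.
  by have := uj 2%N isT; rewrite /= mulr1 subr0 => /ltW.
have uN1 : cheb u m.+1 = 1.
  have := cheb_det u m.+1; rewrite uN expr0n mulr0 mul0r subr0 add0r => /eqP.
  rewrite sqrf_eq1 => /orP[/eqP //|/eqP h].
  by have := uj m.+1; rewrite h oppr_gt0 ltr10 => /(_ (ltnSn _)).
have cpos k : (k * 2 < m.+2)%N -> 0 < cheb2cos u k.
  case: k => [_|k hk]; first by rewrite /cheb2cos /= mulr1 mulr0 subr0 ltr0n.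
  have := cheb_mul u 2 k.+1; rewrite cheb_2 => /esym h.
  have : 0 < cheb u k.+1 * cheb2cos u k.+1 by rewrite h uj // mulnC hk.
  by rewrite pmulr_rgt0 // uj //=; lia.
have dec k : (k * 2 < m.+2)%N -> cheb2cos u k.+1 < cheb2cos u k.
  move=> hk; have := cheb2cosS u k; have := cpos k hk.
  have : 0 <= cheb u k by case: k hk => // k hk; apply/ltW/uj => /=; lia.
  move: (cheb u k) (cheb2cos u k) (cheb2cos u k.+1) => v x y v0 x0 h.
  have : 0 <= (4 - u ^+ 2) * v by apply: mulr_ge0 => //; nra.
  nra.
split.
- move=> k k0 hk; rewrite cpos //=; elim: k k0 hk => // -[_ _ _|k IH _ hk].
    by rewrite /cheb2cos /= !mulr1 subr0; lra.
  by apply: lt_trans (IH _ _) => //; [apply: dec|]; lia.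
- move=> k k0 hk; have := cheb_mul u 3 k; rewrite cheb_3 => /esym h.
  have : 0 < cheb u (3 * k) by apply: uj; lia.
  rewrite -h pmulr_rgt0; last by apply: uj; lia.
  have c0 : 0 < cheb2cos u k by apply: cpos; lia.
  by move: (cheb2cos u k) c0 => x x0; nra.
- by move=> k k0 hk; apply: dec; lia.
move=> k k0 hk.
have vk : 0 < cheb u k by apply: uj; lia.
have shift j n : cheb u (m.+2 * j + n) = (-1) ^+ j * cheb u n.
  elim: j => [|j IH]; first by rewrite muln0 mul1r.
  by rewrite mulnS -addnA (cheb_shift uN uN1) IH exprS mulN1r mulNr.
split; apply: (mulfI (lt0r_neq0 vk)); rewrite -cheb_mul.
  by rewrite mulr0 -[(_ * _)%N]addn0 shift mulr0.
(* With (m + 2) t = pi, the angle (m + 1) k t is k - 1 half turns plus pi - kt, which gives the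
   sign. *)
have -> : (m.+1 * k = m.+2 * k.-1 + (m.+2 - k))%N by case: k k0 hk {vk} => // k _ hk; nia.
rewrite shift (cheb_refl uN uN1); last lia.
by rewrite mulrC; case: k k0 {hk vk} => // k _; rewrite !exprS !mulN1r opprK.
Qed.
End ChebNodes.

(** * The branch of equimodular roots *)

Lemma PmS3 (R : comNzRingType) (c : R) (B A : {poly R}) m :
  Pm c B A m.+3 =
  - (c%:P * Pm c B A m.+2) - B * Pm c B A m.+1 - A * Pm c B A m.
Proof.
have next n : Ptriple c B A n.+1 = let: (p0, p1, p2) := Ptriple c B A n in
    (p1, p2, - (c%:P * p2) - B * p1 - A * p0) by [].
rewrite /Pm !next; by case: (Ptriple c B A m) => [[p0 p1] p2].
Qed.

Definition Qm (R : comNzRingType) (a b : R) (m : nat) : {poly R} :=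
  Pm 1 (a%:P - b *: 'X) 'X m.

Lemma QmS3 (R : comNzRingType) (a b : R) m : Qm a b m.+3 =
  - Qm a b m.+2 - (a%:P - b *: 'X) * Qm a b m.+1 - 'X * Qm a b m.
Proof. by rewrite /Qm PmS3 mul1r. Qed.

(** With U = u^2 and s = 1 + z / u, u times this is a (z + u)^3 - (z + u) (1 + u z) - b z. In the
    unknown s only the square of u occurs. *)
Definition crit (R : comNzRingType) (a b U s : R) : R :=
  a * U * s ^+ 3 - U * s ^+ 2 + (U - 1 - b) * s + b.

(** The divided difference of [crit] in s; on the diagonal it is the derivative. *)
Definition critdiff (R : comNzRingType) (a b U s t : R) : R :=
  a * U * (s ^+ 2 + s * t + t ^+ 2) - U * (s + t) + (U - 1 - b).

Section Eval.
Variable F : fieldType.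
Implicit Types a b u s w : F.

Lemma crit_sub a b U s t : crit a b U s - crit a b U t = (s - t) * critdiff a b U s t.
Proof. by rewrite /crit /critdiff; ring. Qed.

Lemma horner_Qm0 a b w : (Qm a b 0).[w] = 1.
Proof. exact: hornerC. Qed.

Lemma horner_Qm1 a b w : (Qm a b 1).[w] = -1.
Proof. by rewrite /Qm /Pm /= !hornerE. Qed.

Lemma horner_Qm2 a b w : (Qm a b 2).[w] = 1 - (a - b * w).
Proof. by rewrite /Qm /Pm /= !hornerE. Qed.

Lemma horner_QmS3 a b w m : (Qm a b m.+3).[w] =
  - (Qm a b m.+2).[w] - (a - b * w) * (Qm a b m.+1).[w] - w * (Qm a b m).[w].
Proof. by rewrite /Qm PmS3 !hornerE. Qed.

(* With [u = 2 cos t], the roots of x^3 + x^2 + (a - b w) x + w are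
   r e^(it), r e^(-it), r z for z = (s - 1) u and r = - 1 / (u s), and the right hand
   side is h_m(e^(it), e^(-it), z) (1 - u z + z^2). *)
Lemma horner_Qm_cheb a b u s m (z := (s - 1) * u) :
  u != 0 -> s != 0 -> crit a b (u ^+ 2) s = 0 ->
  (Qm a b m).[(s - 1) / (s ^+ 3 * u ^+ 2)] * (1 - u * z + z ^+ 2) * (- (u * s)) ^+ m
  = cheb u m.+1 - z * cheb u m.+2 + z ^+ m.+2.
Proof.
move=> u0 s0 hs; set w := _ / _.
(* By these identities, scaling the m-th term by (- (u s))^m gives a recurrence with characteristic
   polynomial (x - z) (x^2 - u x + 1). *)
have e3 : (u * s) ^+ 3 * w = z by rewrite /w /z; field; rewrite u0 s0.
have e2 : (u * s) ^+ 2 * (a - b * w) = 1 + u * z.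
  apply: (mulfI s0); rewrite /w /z -[RHS]addr0 -hs /crit; field; by rewrite u0 s0.
have e1 : u * s = u + z by rewrite /z; ring.
move: w e2 e3 => w e2 e3; rewrite {}e1 in e2 e3 *.
elim/ltn_ind: m => -[_|[_|[_|m IH]]].
- by rewrite horner_Qm0 /=; ring.
- by rewrite horner_Qm1 /=; ring.
- rewrite horner_Qm2 /=.
  transitivity ((1 - u * z + z ^+ 2) * ((u + z) ^+ 2 - (u + z) ^+ 2 * (a - b * w))).
    by ring.
  by rewrite e2; ring.
have I0 := IH m ltac:(lia); have I1 := IH m.+1 ltac:(lia).
have I2 := IH m.+2 ltac:(lia).
set d := 1 - u * z + z ^+ 2 in I0 I1 I2 *.
set e := u + z in e2 e3 I0 I1 I2 *.
rewrite horner_QmS3.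
transitivity (e * ((Qm a b m.+2).[w] * d * (- e) ^+ m.+2)
  - e ^+ 2 * (a - b * w) * ((Qm a b m.+1).[w] * d * (- e) ^+ m.+1) * (- e) ^+ 0
  + e ^+ 3 * w * ((Qm a b m).[w] * d * (- e) ^+ m)).
  by rewrite !exprS; ring.
rewrite I0 I1 I2 e2 e3 /e !(chebSS u m.+2) !(chebSS u m.+1) (chebSS u m.+3).
by rewrite !(chebSS u m.+2) !(chebSS u m.+1) !exprS; ring.
Qed.

End Eval.

Definition admissible (R : rcfType) (a b : R) : Prop :=
  [/\ 0 <= b, 0 <= 1 + a + b & 0 <= 9 - 27 * a + b].

Section Branch.
Variable R : rcfType.
Variables a b : R.
Implicit Types u s t : R.

(* The unknown is s = 1 + z / u, so that |z| < 1 and z + u > 0. *)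
Definition in_disc (u s : R) := [/\ 0 < s, -1 < (s - 1) * u & (s - 1) * u < 1].

Lemma crit_shift u z : u != 0 ->
  crit a b (u ^+ 2) (1 + z / u) * u = a * (z + u) ^+ 3 - (z + u) * (1 + z * u) - b * z.
Proof. by move=> u0; rewrite /crit; field. Qed.

(** At z = 1 the cubic is a v^3 - v^2 - b with v = 1 + u < 3. The bound 27 a <= 9 + b makes 27 times
    it at most (v - 3) (9 v^2 + b (v^2 + 3 v + 9)). *)
Lemma crit_hi u : admissible a b -> 0 < u < 2 -> crit a b (u ^+ 2) (1 + 1 / u) < 0.
Proof.
move=> [b0 hab1 hab2] /andP[u0 u2]; rewrite -(pmulr_llt0 _ u0) crit_shift ?gt_eqF //.
rewrite !mul1r mulr1; set v := 1 + u.
have v0 : 0 < v by rewrite /v; lra.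
have v3 : 0 < 3 - v by rewrite /v; lra.
have h1 : 0 <= (9 - 27 * a + b) * v ^+ 3 by rewrite mulr_ge0 // exprn_ge0 ?ltW.
have h2 : 0 < (3 - v) * v ^+ 2 by rewrite mulr_gt0 // exprn_gt0.
have h3 : 0 <= b * ((3 - v) * (v ^+ 2 + 3 * v + 9)).
  by rewrite mulr_ge0 // mulr_ge0 ?ltW //; nra.
nra.
Qed.

(** At z = -1 the cubic is a (u - 1)^3 + (u - 1)^2 + b. For u > 1 the bound a >= -1 - b applies; for
    u < 1 the expression is the opposite of the one met at z = 1, with v = 1 - u, and the other
    inequality applies; for u = 1 it is b. *)
Lemma crit_lo u : admissible a b -> 0 < u < 2 -> (0 < b) || (1 < u) ->
  0 < crit a b (u ^+ 2) (1 + (-1) / u).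
Proof.
move=> [b0 hab1 hab2] /andP[u0 u2] hbu; rewrite -(pmulr_lgt0 _ u0) crit_shift ?gt_eqF //.
have -> : a * (-1 + u) ^+ 3 - (-1 + u) * (1 + -1 * u) - b * -1
  = a * (u - 1) ^+ 3 + (u - 1) ^+ 2 + b by ring.
have [u1|u1|u1] := ltrgtP u 1; last first.
- by move: hbu; rewrite u1 ltxx orbF subrr !expr0n /= mulr0 !add0r.
- have v0 : 0 < u - 1 by lra.
  have v1 : 0 < 1 - (u - 1) by lra.
  move: (u - 1) v0 v1 => v v0 v1.
  have h1 : 0 <= (1 + a + b) * v ^+ 3 by rewrite mulr_ge0 // exprn_ge0 ?ltW.
  have h2 : 0 < (1 - v) * v ^+ 2 by rewrite mulr_gt0 // exprn_gt0.
  have h3 : 0 <= b * ((1 - v) * (v ^+ 2 + v + 1)).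
    by rewrite mulr_ge0 // mulr_ge0 ?ltW //; nra.
  nra.
have {}hbu : 0 < b by move: hbu; rewrite [1 < u]lt_gtF ?orbF.
have v0 : 0 < 1 - u by lra.
have v1 : 0 < 3 - (1 - u) by lra.
have -> : a * (u - 1) ^+ 3 + (u - 1) ^+ 2 + b = (1 - u) ^+ 2 + b - a * (1 - u) ^+ 3.
  by ring.
move: (1 - u) v0 v1 => v v0 v1.
have h1 : 0 <= (9 - 27 * a + b) * v ^+ 3 by rewrite mulr_ge0 // exprn_ge0 ?ltW.
have h2 : 0 < (3 - v) * v ^+ 2 by rewrite mulr_gt0 // exprn_gt0.
have h3 : 0 <= b * ((3 - v) * (v ^+ 2 + 3 * v + 9)).
  by rewrite mulr_ge0 // mulr_ge0 ?ltW //; nra.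
nra.
Qed.

Lemma in_discP u s : 0 < u ->
  in_disc u s <-> Num.max 0 (1 + (-1) / u) < s /\ s < 1 + 1 / u.
Proof.
move=> u0; rewrite /in_disc gt_max -(ltr_pdivlMr _ _ u0) -(ltr_pdivrMr _ _ u0).
rewrite ltrBrDl ltrBlDl; split=> [[-> -> ->]|[/andP[]]] //.
Qed.

Lemma crit_max u : admissible a b -> 0 < u < 2 -> (0 < b) || (1 < u) ->
  0 < crit a b (u ^+ 2) (Num.max 0 (1 + (-1) / u)).
Proof.
move=> adm u02 hbu; rewrite /Num.max; case: ifP => [_|/negbT]; first exact: crit_lo adm _ _.
(* The endpoint is now 0, where the cubic takes the value b. *)
rewrite -leNgt => h; rewrite /crit !expr0n /= !mulr0 subr0 !add0r.
case/orP: hbu => // u1; have /andP[u0 u2] := u02.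
by move: h; rewrite mulN1r subr_le0 leNgt invf_lt1 ?u1.
Qed.

Lemma crit_root u : admissible a b -> 0 < u < 2 -> (0 < b) || (1 < u) ->
  exists2 s, in_disc u s & crit a b (u ^+ 2) s = 0.
Proof.
move=> adm u02 hbu; have lo := crit_max adm u02 hbu; have hi := crit_hi adm u02.
have /andP[u0 _] := u02.
set l := Num.max _ _ in lo *; set h := 1 + 1 / u in hi *.
pose p : {poly R} := a * u ^+ 2 *: 'X^3 - u ^+ 2 *: 'X^2 + (u ^+ 2 - 1 - b) *: 'X + b%:P.
have pE (s : R) : p.[s] = crit a b (u ^+ 2) s by rewrite /p /crit !hornerE.
have lh : l <= h.
  rewrite /l /h ge_max; apply/andP; split.
    by rewrite addr_ge0 // divr_ge0 // ltW.
  by rewrite lerD2l ler_pM2r ?invr_gt0 //; lra.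
have [|s si rs] := polyrcf.poly_ivtoo (p := p) lh; first by rewrite !pE pmulr_rlt0.
exists s; last by rewrite -pE; apply/rootP.
by apply/in_discP => //; move: si; rewrite in_itv /= => /andP[].
Qed.

(** For a < 0 this is a direct estimate. For a >= 0, [critdiff] is convex in s, and it is negative
    at both ends of the interval because [crit] changes sign there around its root t. Hence [crit]
    is positive to the left of t and negative to its right. *)
Lemma critdiff_lt0 u s t : admissible a b -> 0 < u < 2 -> (0 < b) || (1 < u) ->
  in_disc u s -> in_disc u t -> crit a b (u ^+ 2) t = 0 -> critdiff a b (u ^+ 2) s t < 0.
Proof.
move=> adm u02 hbu hs ht ct; have /andP[u0 u2] := u02.
have [b0 _ _] := adm.
have [a0|a0] := ltP a 0.
  case: hs ht => s0 s1 s2 [t0 t1 t2]; rewrite /critdiff.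
  have : a * u ^+ 2 * (s ^+ 2 + s * t + t ^+ 2) <= 0.
    rewrite pmulr_lle0 ?pmulr_lle0 ?exprn_gt0 ?(ltW a0) //.
    by rewrite !addr_gt0 ?exprn_gt0 ?mulr_gt0.
  have : 0 < u * ((s - 1) * u + (t - 1) * u + 2) by rewrite mulr_gt0 //; lra.
  have : 0 <= (u - 1) ^+ 2 by exact: sqr_ge0.
  lra.
have hi := crit_hi adm u02; have lo := crit_max adm u02 hbu.
have [l1 l2] := (in_discP s u0).1 hs; have [m1 m2] := (in_discP t u0).1 ht.
move: (Num.max _ _) (1 + 1 / u) hi lo l1 l2 m1 m2 => l h hi lo ls sh lt th.
have dl : critdiff a b (u ^+ 2) l t < 0.
  by have := crit_sub a b (u ^+ 2) l t; rewrite ct subr0 => E;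
     move: lo; rewrite E nmulr_rgt0 ?subr_lt0.
have dh : critdiff a b (u ^+ 2) h t < 0.
  by have := crit_sub a b (u ^+ 2) h t; rewrite ct subr0 => E;
     move: hi; rewrite E pmulr_rlt0 ?subr_gt0.
(* Chord interpolation of a quadratic in s with leading coefficient a u^2. *)
rewrite -(pmulr_llt0 _ (_ : 0 < h - l)); last by lra.
have -> : critdiff a b (u ^+ 2) s t * (h - l) = critdiff a b (u ^+ 2) l t * (h - s)
  + critdiff a b (u ^+ 2) h t * (s - l) - a * u ^+ 2 * ((h - l) * (s - l) * (h - s)).
  by rewrite /critdiff; ring.
have : 0 <= a * u ^+ 2 * ((h - l) * (s - l) * (h - s)).
  by rewrite !mulr_ge0 ?exprn_ge0 //; lra.
nra.
Qed.

(** The combination 3 [crit] - s [critdiff] on the diagonal eliminates a. The bound 3/2 is where (s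
    - 1) / s^3 stops increasing. *)
Lemma crit_lt32 u s : admissible a b -> 0 < u < 2 -> (0 < b) || (1 < u) ->
  in_disc u s -> crit a b (u ^+ 2) s = 0 -> s < 3 / 2.
Proof.
move=> adm u02 hbu hs cs; have := critdiff_lt0 adm u02 hbu hs hs cs; have /andP[u0 u2] := u02.
have [b0 _ _] := adm; case: hs => s0 _ _ d; rewrite ltNge; apply/negP => h.
have : 0 < 3 * crit a b (u ^+ 2) s - s * critdiff a b (u ^+ 2) s s by rewrite cs; nra.
have -> : 3 * crit a b (u ^+ 2) s - s * critdiff a b (u ^+ 2) s s
  = - b * (2 * s - 3) + s * (2 * (u ^+ 2 - 1) - u ^+ 2 * s).
  by rewrite /crit /critdiff; ring.
have : 0 <= b * (2 * s - 3) by rewrite mulr_ge0 //; lra.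
have : 0 <= s * (u ^+ 2 * (s - 3 / 2)) by rewrite !mulr_ge0 ?exprn_ge0 //; lra.
have : 0 < s * (4 - u ^+ 2) by rewrite mulr_gt0 //; nra.
nra.
Qed.

Lemma ratio_mono (s t : R) : 0 < s -> 0 < t -> s < 3 / 2 -> t < 3 / 2 ->
  ((s - 1) / s ^+ 3 < (t - 1) / t ^+ 3) = (s < t).
Proof.
have mono (x y : R) : 0 < x -> x < 3 / 2 -> y < 3 / 2 -> x < y ->
    (x - 1) / x ^+ 3 < (y - 1) / y ^+ 3.
  move=> x0 x3 y3 xy; have y0 : 0 < y by lra.
  rewrite ltr_pdivrMr ?exprn_gt0 // mulrAC ltr_pdivlMr ?exprn_gt0 // -subr_gt0.
  have -> : (y - 1) * x ^+ 3 - (x - 1) * y ^+ 3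
    = (y - x) * (x ^+ 2 + x * y + y ^+ 2 - x * y * (x + y)) by ring.
  rewrite mulr_gt0 ?subr_gt0 //.
  have : 0 < x * y * (3 - (x + y)) by rewrite !mulr_gt0 //; lra.
  have : 0 < (y - x) ^+ 2 by rewrite exprn_gt0 // subr_gt0.
  nra.
move=> s0 t0 s3 t3; have [st|ts|->] := ltrgtP s t; last exact: ltxx.
  by rewrite mono.
by apply/negbTE; rewrite -leNgt ltW ?mono.
Qed.


(** A cubic with root x - 1 and two further roots of sum -x and product p has e1 = -1, e2 = p + x -
    x^2 and - e3 = p (1 - x). Values of e2 are compared at equal e3, the condition [x ^+ 2 < 4 * p]
    making the pair nonreal. It bounds the decisive factor below by the square (x / 2 - (1 -
    y))^2. *)
Lemma e2_lt (x y p q : R) : p * (1 - x) = q * (1 - y) -> x ^+ 2 < 4 * p ->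
  0 < (y - x) * (1 - y) -> p + x - x ^+ 2 < q + y - y ^+ 2.
Proof.
move=> pq xp xy; have y1 : 1 - y != 0.
  by apply: contraTneq xy => ->; rewrite mulr0 ltxx.
have y2 : 0 < (1 - y) ^+ 2 by rewrite lt0r sqrf_eq0 y1 sqr_ge0.
rewrite -subr_gt0 -(pmulr_lgt0 _ y2).
have -> : (q + y - y ^+ 2 - (p + x - x ^+ 2)) * (1 - y) ^+ 2
  = (1 - y) * (q * (1 - y) - p * (1 - y) + (y - x) * (1 - x - y) * (1 - y)) by ring.
rewrite -pq.
have -> : (1 - y) * (p * (1 - x) - p * (1 - y) + (y - x) * (1 - x - y) * (1 - y))
  = ((y - x) * (1 - y)) * (p + (1 - y) * (1 - x - y)) by ring.
rewrite mulr_gt0 //; have : 0 <= (x / 2 - (1 - y)) ^+ 2 by exact: sqr_ge0.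
nra.
Qed.

(** If w did not increase, some r <= s would give on the line u the same w as t gives on the line v.
    Then [e2_lt] makes [crit] negative at r, whereas [crit] is nonnegative to the left of its root
    s. *)
Lemma branch_mono u v s t : admissible a b ->
  0 < u -> u < v -> v < 2 -> (0 < b) || (1 < u) ->
  in_disc u s -> crit a b (u ^+ 2) s = 0 -> in_disc v t -> crit a b (v ^+ 2) t = 0 ->
  (s - 1) / (s ^+ 3 * u ^+ 2) < (t - 1) / (t ^+ 3 * v ^+ 2).
Proof.
move=> adm u0 uv v2 hbu hs cs ht ct; rewrite ltNge; apply/negP.
have [v0 u2] : 0 < v /\ u < 2 by split; lra.
have u02 : 0 < u < 2 by rewrite u0.
have v02 : 0 < v < 2 by rewrite v0.
have hbv : (0 < b) || (1 < v).
  by case/orP: hbu => [->//|u1]; rewrite (lt_trans u1 uv) orbT.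
have s32 := crit_lt32 adm u02 hbu hs cs; have t32 := crit_lt32 adm v02 hbv ht ct.
have [s0 s1 s2] := hs; have [t0 t1 t2] := ht.
set w := (t - 1) / _ => le_w.
have wE : v ^+ 2 * w = (t - 1) / t ^+ 3.
  by rewrite /w; field; rewrite !gt_eqF.
(* [r] is the point of the line [u] where the parameter takes the value [w]. *)
have [r [r0 rs rE]] : exists r : R, [/\ 0 < r, r <= s & (r - 1) / r ^+ 3 = u ^+ 2 * w].
  pose p : {poly R} := u ^+ 2 * w *: 'X^3 - 'X + 1.
  have pE (x : R) : p.[x] = u ^+ 2 * w * x ^+ 3 - x + 1 by rewrite /p !hornerE.
  have [|r /andP[r0 rs] /rootP] := poly_ivt (p := - p) (ltW s0).
    rewrite !hornerN !pE; apply/andP; split; first by rewrite expr0n /= mulr0; lra.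
    have : u ^+ 2 * w * s ^+ 3 <= s - 1; last lra.
    have : w * (s ^+ 3 * u ^+ 2) <= s - 1 by rewrite -ler_pdivlMr ?mulr_gt0 ?exprn_gt0.
    nra.
  rewrite hornerN pE => /eqP; rewrite oppr_eq0 => /eqP pr.
  have rn0 : r != 0.
    apply: contra_eq_neq pr => ->.
    by rewrite expr0n mulr0 sub0r oppr0 add0r oner_neq0.
  exists r; split=> //; first by rewrite lt_neqAle eq_sym rn0.
  have -> : r - 1 = u ^+ 2 * w * r ^+ 3 by rewrite -[RHS]subr0 -pr; ring.
  by rewrite mulfK // expf_neq0.
have r32 : r < 3 / 2 by apply: le_lt_trans s32.
have uv2 : u ^+ 2 < v ^+ 2 by rewrite ltr_pXn2r ?nnegrE ?ltW.
have sgw (x : R) : 0 < x -> (0 < (x - 1) / x ^+ 3) = (1 < x).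
  by move=> x0; rewrite pmulr_lgt0 ?invr_gt0 ?exprn_gt0 // subr_gt0.
have sgw' (x : R) : 0 < x -> (0 == (x - 1) / x ^+ 3) = (x == 1).
  by move=> x0; rewrite eq_sym mulf_eq0 invr_eq0 expf_eq0 (gt_eqF x0) andbF orbF subr_eq0.
(* Since u < v, u^2 w lies between 0 and v^2 w, so r lies strictly between 1 and t unless w = 0. *)
have rt : [\/ [/\ 0 < w, 1 < r & r < t], [/\ w < 0, r < 1 & t < r]
             | [/\ w = 0, r = 1 & t = 1]].
  have [w0|w0|w0] := ltrgtP w 0.
  - constructor 2; split=> //.
      have := sgw' r r0; have := sgw r r0; rewrite rE.
      rewrite pmulr_rgt0 ?exprn_gt0 // (lt_gtF w0) eq_sym mulf_eq0 (lt_eqF w0).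
      rewrite expf_eq0 (gt_eqF u0) /= => /esym/negbT; rewrite -leNgt => h /esym/negbT h'.
      by rewrite lt_neqAle h' h.
    by rewrite -ratio_mono // rE -wE ltr_nM2r.
  - constructor 1; split=> //; first by rewrite -sgw // rE mulr_gt0 ?exprn_gt0.
    by rewrite -ratio_mono // rE -wE ltr_pM2r.
  - constructor 3; split=> //; apply/eqP.
      by rewrite -sgw' // rE w0 mulr0.
    by rewrite -sgw' // -wE w0 mulr0.
have rd : in_disc u r.
  split=> //; last by apply: le_lt_trans s2; rewrite ler_pM2r // lerD2r.
  case: rt => [[_ r1 _]|[_ r1 tr]|[_ r1 _]].
  - by apply: lt_trans (ltrN10 _) _; rewrite mulr_gt0 ?subr_gt0.
  - have : (1 - r) * u < 1; last nra.
    have : (1 - t) * v < 1 by nra.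
    apply: le_lt_trans; rewrite ler_pM ?subr_ge0 ?ltW //; lra.
  - by rewrite r1 subrr mul0r ltrN10.
(* As [crit] vanishes at (v, t), a - b w is the value of e2 there, and [crit] at (u, r) is a
   positive multiple of e2 at (v, t) minus e2 at (u, r). *)
have neg : crit a b (u ^+ 2) r < 0.
  have aE : a - b * w = 1 / (v ^+ 2 * t ^+ 2) + (t - 1) / t ^+ 2.
    apply/eqP; rewrite -subr_eq0.
    have -> : a - b * w - (1 / (v ^+ 2 * t ^+ 2) + (t - 1) / t ^+ 2)
      = crit a b (v ^+ 2) t / (v ^+ 2 * t ^+ 3).
      by rewrite /w /crit; field; rewrite !gt_eqF.
    by rewrite ct mul0r.
  have r1 : r - 1 = u ^+ 2 * w * r ^+ 3.
    by rewrite -rE divfK // expf_neq0 // gt_eqF.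
  have -> : crit a b (u ^+ 2) r = u ^+ 2 * r ^+ 3 *
     ((1 / (v ^+ 2 * t ^+ 2) + (t - 1) / t ^+ 2)
      - (1 / (u ^+ 2 * r ^+ 2) + (r - 1) / r ^+ 2)).
    rewrite -aE.
    transitivity (u ^+ 2 * r ^+ 3 * a - b * (r - 1)
      - u ^+ 2 * r ^+ 3 * (1 / (u ^+ 2 * r ^+ 2) + (r - 1) / r ^+ 2)).
      by rewrite /crit; field; rewrite !gt_eqF.
    by rewrite {1}r1; ring.
  rewrite pmulr_rlt0 ?mulr_gt0 ?exprn_gt0 // subr_lt0.
  have eE (x p : R) : 0 < x -> 1 / (p * x ^+ 2) + (x - 1) / x ^+ 2
      = (x ^- 2 / p) + x^-1 - x^-1 ^+ 2.
    by move=> x0; rewrite mul1r invfM [p^-1 * _]mulrC -addrA; congr (_ + _);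
       field; rewrite gt_eqF.
  have {rt} [rt|[-> ->]] : 0 < (t - r) * (r - 1) \/ (r = 1 /\ t = 1).
    - case: rt => [[_ r1' tr]|[_ r1' tr]|[_ r1' tr]]; last by right.
        by left; rewrite mulr_gt0 ?subr_gt0.
      by left; rewrite nmulr_rgt0 ?subr_lt0.
  - rewrite !eE //; apply: e2_lt.
    - transitivity w; first by rewrite /w; field; rewrite !gt_eqF.
      apply: (mulfI (_ : u ^+ 2 != 0)); first by rewrite expf_neq0 // gt_eqF.
      by rewrite -rE; field; rewrite !gt_eqF.
    - rewrite exprVn -subr_gt0.
      have -> : 4 * (t ^- 2 / v ^+ 2) - t ^- 2 = t ^- 2 / v ^+ 2 * (4 - v ^+ 2).
        by field; rewrite !gt_eqF.
      by rewrite !mulr_gt0 ?invr_gt0 ?exprn_gt0 // subr_gt0; nra.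
    have -> : (r^-1 - t^-1) * (1 - r^-1) = (t - r) * (r - 1) / (r ^+ 2 * t).
      by field; rewrite !gt_eqF.
    by rewrite divr_gt0 // mulr_gt0 ?exprn_gt0.
  - rewrite !eE // !expr1n !invr1 !mul1r !ltrD2r.
    by rewrite ltf_pV2 ?posrE ?exprn_gt0.
have := crit_sub a b (u ^+ 2) r s; rewrite cs subr0 => E; move: neg; rewrite E.
have d := critdiff_lt0 adm u02 hbu rd hs cs.
by rewrite nmulr_llt0 // subr_gt0 ltNge rs.
Qed.

End Branch.

(** * Sufficiency *)

Section RealRooted.
Variable R : rcfType.
Implicit Types p q : {poly R}.

Lemma real_rootedM p q : real_rooted p -> real_rooted q -> real_rooted (p * q).
Proof.
move=> [s hs] [t ht]; exists (s ++ t).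
by rewrite big_cat lead_coefM {1}hs {1}ht -scalerAl -scalerAr scalerA.
Qed.

Lemma real_rooted_prod (s : seq R) : real_rooted (\prod_(x <- s) ('X - x%:P)).
Proof. by exists s; rewrite lead_coef_prod_XsubC scale1r. Qed.

Lemma real_rooted_size2 p : (size p <= 2)%N -> real_rooted p.
Proof.
move=> sp; have pE : p = p`_1 *: 'X + (p`_0)%:P.
  apply/polyP => -[|[|i]]; rewrite coefD coefZ coefX coefC /= ?mulr0 ?mulr1 ?add0r ?addr0 //.
  by rewrite nth_default // (leq_trans sp).
have [p1|p1] := eqVneq p`_1 0.
  by exists [::]; rewrite big_nil pE p1 scale0r add0r lead_coefC alg_polyC.
exists [:: - (p`_0 / p`_1)]; rewrite big_seq1 polyCN opprK.
have -> : lead_coef p = p`_1.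
  rewrite lead_coefE; suff -> : size p = 2%N by [].
  by apply/eqP; rewrite eqn_leq sp ltnNge; apply: contra p1 => /leq_sizeP->.
by rewrite [LHS]pE scalerDr -[_ *: _%:P]mul_polyC -polyCM mulrC divfK.
Qed.

(** The d - 1 sign changes split off d - 1 real linear factors; the cofactor has degree at most 1,
    so it is real-rooted as well. *)
Lemma real_rooted_alternating p d (w : nat -> R) : (size p <= d.+1)%N ->
  (forall k, (k.+1 < d)%N -> w k.+1 < w k /\ p.[w k] * p.[w k.+1] < 0) -> real_rooted p.
Proof.
move=> sp hw; have [->|p0] := eqVneq p 0.
  by exists [::]; rewrite lead_coef0 scale0r.
(* All roots found so far exceed [w n], so the next one, below [w n], is new. *)
have [rs [srs urs rrs _]] : exists rs, [/\ size rs = d.-1, uniq rs, all (root p) rs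
    & all (fun x => w d.-1 < x) rs].
  have: (d.-1 <= d.-1)%N by [].
  move: {-2}(d.-1) => n; elim: n => [|n IH] hn; first by exists [::].
  have [rs [srs urs rrs wrs]] := IH (ltnW hn).
  have [ww pw] := hw n ltac:(lia).
  have [|r] := polyrcf.poly_ivtoo (p := p) (ltW ww); first by rewrite mulrC.
  rewrite in_itv /= => /andP[r1 r2] rr; exists (r :: rs); split=> /=.
  - by rewrite srs.
  - rewrite urs andbT; apply/negP => /(allP wrs) /=.
    by rewrite ltNge (ltW r2).
  - by rewrite rr.
  - by rewrite r1; apply/allP => x /(allP wrs) /=; apply: lt_trans ww.
have [|q pq] := uniq_roots_prod_XsubC rrs; first by rewrite uniq_rootsE.
rewrite pq; apply: real_rootedM (real_rooted_prod _).
apply: real_rooted_size2; move: sp p0; rewrite pq.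
have [->|q0] := eqVneq q 0; first by rewrite size_poly0.
rewrite size_Mmonic ?monic_prod_XsubC // size_prod_XsubC srs => + _.
lia.
Qed.

End RealRooted.

Section Sufficiency.
Variable R : rcfType.
Implicit Types a b : R.

Lemma size_Qm a b m : (size (Qm a b m) <= (m %/ 2).+1)%N.
Proof.
elim/ltn_ind: m => -[|[|[|m]]] IH.
- by rewrite /Qm /Pm /= size_poly1.
- by rewrite /Qm /Pm /= size_polyN size_polyC oner_neq0.
- rewrite /Qm /Pm /=; apply: leq_trans (size_polyD _ _) _; rewrite geq_max size_polyN.
  rewrite -polyCM size_polyC; apply/andP; split; first by case: (_ == _).
  apply: leq_trans (size_polyD _ _) _; rewrite geq_max size_polyN.
  rewrite size_polyC (leq_trans (size_scale_leq _ _)) ?size_polyX // andbT.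
  by case: (_ == _).
have IH0 := IH m ltac:(lia); have IH1 := IH m.+1 ltac:(lia); have IH2 := IH m.+2 ltac:(lia).
have sX : size ('X : {poly R}) = 2%N by rewrite size_polyX.
rewrite QmS3.
apply: leq_trans (size_polyD _ _) _; rewrite geq_max size_polyN; apply/andP; split; last first.
  rewrite (leq_trans (size_polyMleq _ _)) // sX; move: (size _) IH0 => n; clear; lia.
apply: leq_trans (size_polyD _ _) _; rewrite geq_max !size_polyN; apply/andP; split.
  by apply: leq_trans IH2 _; clear; lia.
have : (size (a%:P - b *: 'X)%R <= 2)%N.
  apply: leq_trans (size_polyD _ _) _; rewrite geq_max size_polyN.
  rewrite size_polyC (leq_trans (size_scale_leq _ _)) ?size_polyX // andbT.
  by case: (_ == _).
move=> h; apply: leq_trans (size_polyMleq _ _) _.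
by move: (size _) (size _) IH1 h => n n'; clear; lia.
Qed.

(** For b = 0 only the coefficient of t^3 contains z, and the degree drops to match the fewer nodes,
    those with u > 1. *)
Lemma size_Qm_b0 a m : (size (Qm a 0 m) <= (m %/ 3).+1)%N.
Proof.
elim/ltn_ind: m => -[|[|[|m]]] IH.
- by rewrite /Qm /Pm /= size_poly1.
- by rewrite /Qm /Pm /= size_polyN size_polyC oner_neq0.
- rewrite /Qm /Pm /= scale0r subr0 -polyCM -polyCB size_polyC.
  by case: (_ == _).
have IH0 := IH m ltac:(lia); have IH1 := IH m.+1 ltac:(lia); have IH2 := IH m.+2 ltac:(lia).
have sX : size ('X : {poly R}) = 2%N by rewrite size_polyX.
rewrite QmS3 scale0r subr0.
apply: leq_trans (size_polyD _ _) _; rewrite geq_max size_polyN; apply/andP; split; last first.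
  by rewrite (leq_trans (size_polyMleq _ _)) // sX; move: (size _) IH0 => n; clear; lia.
apply: leq_trans (size_polyD _ _) _; rewrite geq_max !size_polyN; apply/andP; split.
  by apply: leq_trans IH2 _; clear; lia.
rewrite mul_polyC (leq_trans (size_scale_leq _ _)) //; apply: leq_trans IH1 _; clear; lia.
Qed.

(** At a node the closed form reduces to (-1)^k + z^(m + 2), whose sign is (-1)^k because |z| < 1.
    The factor 1 - u z + z^2 is positive as u < 2, and (- (u s))^m contributes (-1)^m. *)
Lemma Qm_sign a b (u s : R) m k : 0 < u < 2 -> in_disc u s ->
  crit a b (u ^+ 2) s = 0 -> cheb u m.+2 = 0 -> cheb u m.+1 = (-1) ^+ k ->
  0 < (-1) ^+ (k + m) * (Qm a b m).[(s - 1) / (s ^+ 3 * u ^+ 2)].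
Proof.
move=> /andP[u0 u2] [s0 s1 s2] cs c0 c1.
have := horner_Qm_cheb m (lt0r_neq0 u0) (lt0r_neq0 s0) cs.
rewrite c0 c1 mulr0 subr0; set z := (s - 1) * u in s1 s2 *; set q := (Qm _ _ _).[_] => E.
have zN : `|z ^+ m.+2| < 1.
  by rewrite normrX exprn_ilt1 // ltr_norml s1.
have d0 : 0 < 1 - u * z + z ^+ 2 by have : 0 <= (2 * z - u) ^+ 2 by [exact: sqr_ge0]; nra.
have us : 0 < (u * s) ^+ m by rewrite exprn_gt0 ?mulr_gt0.
have pos : 0 < (-1) ^+ k * ((-1) ^+ k + z ^+ m.+2).
  rewrite mulrDr -expr2 sqrr_sign.
  suff : `|(-1) ^+ k * z ^+ m.+2| < 1 by rewrite ltr_norml => /andP[]; lra.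
  by rewrite normrM normrX normrN1 expr1n mul1r.
move: pos; rewrite -E [(- (u * s)) ^+ m]exprNn => pos.
rewrite -(pmulr_lgt0 _ d0) -(pmulr_lgt0 _ us); apply: etrans pos; congr (_ < _).
by rewrite exprD; ring.
Qed.

Lemma Qm_real_rooted a b m : admissible a b -> real_rooted (Qm a b m).
Proof.
move=> adm; have [b0 _ _] := adm.
have [c [c02 c1 cdec cz]] := cheb_nodes R m.
pose v := if b == 0 then 3%N else 2%N.
have v2 : (1 < v)%N by rewrite /v; case: ifP.
have cv k : (0 < k)%N -> (k * v < m.+2)%N ->
    [/\ 0 < c k < 2, (0 < b) || (1 < c k) & (k * 2 < m.+2)%N].
  move=> k0 kv; have k2 : (k * 2 < m.+2)%N by nia.
  split=> //; first exact: c02.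
  move: kv; rewrite /v lt0r b0; case: (b == 0) => //= kv; exact: c1.
have sz : (size (Qm a b m) <= (m %/ v).+1)%N.
  by rewrite /v; case: eqP => [->|_]; [apply: size_Qm_b0 | apply: size_Qm].
(* Finite choice of the roots; index 0 is a dummy, the nodes starting at 1. *)
have [s hs] : exists s : 'I_(m %/ v).+1 -> R, forall k : 'I_(m %/ v).+1, (0 < k)%N ->
    in_disc (c k) (s k) /\ crit a b (c k ^+ 2) (s k) = 0.
  apply: (fin_all_exists (P := fun (k : 'I_(m %/ v).+1) (x : R) => (0 < k)%N ->
    in_disc (c k) x /\ crit a b (c k ^+ 2) x = 0)) => k.
  have [->|k0] := posnP k; first by exists 0.
  have [] := cv k k0; first by have := ltn_ord k; nia.
  move=> ck hb _; have [x h1 h2] := crit_root adm ck hb; exists x; split=> //.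
pose w k := (s (inord k.+1) - 1) / (s (inord k.+1) ^+ 3 * c k.+1 ^+ 2).
apply: (@real_rooted_alternating _ _ (m %/ v) w sz) => k kd.
have kv : (k.+2 * v < m.+2)%N by nia.
have [ck hb k2] := cv k.+1 isT ltac:(nia).
have [ck' hb' k2'] := cv k.+2 isT kv.
have e1 : (inord k.+1 : 'I_(m %/ v).+1) = k.+1 :> nat by rewrite inordK //; lia.
have e2 : (inord k.+2 : 'I_(m %/ v).+1) = k.+2 :> nat by rewrite inordK //; lia.
have := hs (inord k.+1); have := hs (inord k.+2); rewrite e1 e2 => /(_ isT)[d2 z2] /(_ isT)[d1 z1].
split.
  have /andP[u0 _] := ck'; have /andP[_ u2] := ck.
  by apply: branch_mono adm _ _ _ _ _ _ _ _ => //; apply: cdec.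
have [x1 y1] := cz k.+1 isT k2; have [x2 y2] := cz k.+2 isT k2'.
have := Qm_sign ck d1 z1 x1 y1; have := Qm_sign ck' d2 z2 x2 y2; rewrite -/(w k) -/(w k.+1).
move=> h1 h2; have := mulr_gt0 h1 h2.
rewrite addSn exprS mulN1r mulNr mulNr mulrACA -expr2 sqrr_sign mul1r oppr_gt0.
by rewrite mulrC.
Qed.

End Sufficiency.

(** * Necessity *)

Section Violation.
Variable R : rcfType.
Implicit Types (a b k U S T P : R) (p q : {poly R}).

(** The equation says that at w = 1 / k^3 the cubic x^3 + x^2 + (a - b w) x + w has roots -1 / k, -
    q / k and -1 / (q k) with q + 1 / q = k - 1; for -1 < k < 3 they have equal modulus. The
    polynomial a x^3 - x^2 - b is - (1 + a + b) at -1 and - (9 - 27 a + b) at 3, so a failing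
    inequality makes it positive at one end. *)
Lemma crossing a b : 0 <= b -> (1 + a + b < 0) || (9 - 27 * a + b < 0) ->
  exists k, [/\ -1 < k, k < 3, k != 0 & a * k ^+ 3 = k ^+ 2 + b].
Proof.
move=> b0 hab; pose p : {poly R} := a *: 'X^3 - 'X^2 - b%:P.
have pE (x : R) : p.[x] = a * x ^+ 3 - x ^+ 2 - b by rewrite /p !hornerE.
have rootE (x : R) : root p x -> a * x ^+ 3 = x ^+ 2 + b.
  by move=> /rootP; rewrite pE => /eqP; rewrite -addrA -opprD subr_eq0 => /eqP.
have a0 : a != 0 by apply: contraTneq hab => ->; rewrite negb_or -!leNgt; apply/andP; split; lra.
(* At 1 / (2 a) one has a x^3 = x^2 / 2, which makes the value negative even for b = 0. *)
have peps : p.[1 / (2 * a)] < 0.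
  rewrite pE; have -> : a * (1 / (2 * a)) ^+ 3 - (1 / (2 * a)) ^+ 2 - b
    = - ((1 / a) ^+ 2 / 8 + b) by field.
  rewrite oppr_lt0 ltr_pwDl // mulr_gt0 ?invr_gt0 ?ltr0n //.
  by rewrite lt0r sqr_ge0 andbT expf_neq0 // mulf_neq0 ?oner_neq0 ?invr_neq0.
case/orP: hab => h.
- have an : a < 0 by lra.
  have e0 : 1 / (2 * a) < 0 by rewrite mul1r invr_lt0; lra.
  have e1 : -1 < 1 / (2 * a) by rewrite ltr_ndivlMr; lra.
  have [|x] := polyrcf.poly_ivtoo (p := p) (ltW e1).
    by rewrite pmulr_rlt0 // pE; lra.
  rewrite in_itv /= => /andP[x1 x2] rx; exists x; split; rewrite ?rootE //.
    by lra.
  by rewrite lt_eqF //; lra.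
- have ap : 1 / 3 < a by lra.
  have e0 : 0 < 1 / (2 * a) by rewrite mul1r invr_gt0; lra.
  have e1 : 1 / (2 * a) < 3 by rewrite ltr_pdivrMr; lra.
  have [|x] := polyrcf.poly_ivtoo (p := p) (ltW e1).
    by rewrite nmulr_rlt0 // pE; lra.
  rewrite in_itv /= => /andP[x1 x2] rx; exists x; split; rewrite ?rootE //.
    by lra.
  by rewrite gt_eqF //; lra.
Qed.

Lemma horner_neg_near p q (x d : R) : 0 < d -> p.[x] < 0 -> q.[x] < 0 ->
  exists y, [/\ x - d < y, y < x, p.[y] < 0 & q.[y] < 0].
Proof.
move=> d0 px qx.
have [d1 d1p h1] : exists2 d1, d1 > 0 & forall y, `|y - x| < d1 -> `|p.[y] - p.[x]| < - p.[x].
  by apply: poly_cont; rewrite oppr_gt0.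
have [d2 d2p h2] : exists2 d2, d2 > 0 & forall y, `|y - x| < d2 -> `|q.[y] - q.[x]| < - q.[x].
  by apply: poly_cont; rewrite oppr_gt0.
pose m := Num.min d (Num.min d1 d2) / 2.
have m0 : 0 < m by rewrite divr_gt0 ?ltr0n // !lt_min d0 d1p.
have : m < Num.min d (Num.min d1 d2).
  by rewrite /m ltr_pdivrMr ?ltr0n // ltr_pMr ?ltr1n // !lt_min d0 d1p.
rewrite !lt_min => /and3P[md md1 md2].
have nm : `|x - m - x| = m by rewrite addrAC subrr add0r normrN gtr0_norm.
exists (x - m); split; [lra | lra | |].
- by have := h1 (x - m); rewrite nm ltr_norml => /(_ md1) /andP[_]; lra.
- by have := h2 (x - m); rewrite nm ltr_norml => /(_ md2) /andP[_]; lra.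
Qed.

Definition cubic_disc (A : comNzRingType) (c3 c2 c1 c0 : A) : A :=
  c2 ^+ 2 * c1 ^+ 2 - 4 * (c3 * c1 ^+ 3) - 4 * (c2 ^+ 3 * c0) - 27 * (c3 ^+ 2 * c0 ^+ 2)
  + 18 * (c3 * c2 * c1 * c0).

Lemma horner_cubic_disc (p3 p2 p1 p0 : {poly R}) (x : R) :
  (cubic_disc p3 p2 p1 p0).[x] = cubic_disc p3.[x] p2.[x] p1.[x] p0.[x].
Proof.
have cst n : (n%:R : {poly R}) = (n%:R)%:P by rewrite rmorph_nat.
by rewrite /cubic_disc !cst !(horner_exp, hornerD, hornerN, hornerM, hornerC).
Qed.

(* The cubic [crit a b U (1 + x)] factors as [a U (x - T) (x ^+ 2 - S x + P)]. *)
Definition crit_factors a b U T S P : Prop :=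
  [/\ 3 * a * U - U = - (a * U * (T + S)),
      3 * a * U - U - 1 - b = a * U * (P + T * S)
    & a * U - 1 = - (a * U * (T * P))].

Lemma cubic_disc_factors (c T S P : R) :
  cubic_disc c (- (c * (T + S))) (c * (P + T * S)) (- (c * (T * P)))
  = c ^+ 4 * (S ^+ 2 - 4 * P) * (T ^+ 2 - S * T + P) ^+ 2.
Proof. by rewrite /cubic_disc; ring. Qed.

Lemma crit_nonreal a b k : 0 <= b -> -1 < k -> k < 3 -> k != 0 ->
  a * k ^+ 3 = k ^+ 2 + b ->
  exists U T S P, [/\ 0 < U < 4, S ^+ 2 < 4 * P, U * P < 1, a != 0 & crit_factors a b U T S P].
Proof.
move=> b0 k1 k3 k0 ak.
have k2 : 0 < k ^+ 2 by rewrite lt0r sqr_ge0 andbT expf_neq0.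
have a0 : a != 0 by apply: contra_eq_neq ak => ->; rewrite mul0r lt_eqF // ltr_pwDl.
have [g g0 ag] : exists2 g, g != 0 & a * g = 1.
  by exists a^-1; rewrite ?invr_neq0 // divff.
have gb : b * g = k ^+ 2 * (k - g).
  have -> : b = a * k ^+ 3 - k ^+ 2 by rewrite ak; ring.
  by transitivity (a * g * k ^+ 3 - k ^+ 2 * g); [ring | rewrite ag; ring].
have aE : a = g^-1 by rewrite -[LHS]mulr1 -(divff g0) mulrA ag mul1r.
have bE : b = k ^+ 2 * (k - g) / g by rewrite -gb mulfK.
have gk : 0 < g * k.
  have : 0 < (g * k) * (k ^+ 2 + b).
    rewrite -ak; have -> : g * k * (a * k ^+ 3) = (a * g) * (k ^+ 2) ^+ 2 by ring.
    by rewrite ag mul1r exprn_gt0.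
  by rewrite pmulr_lgt0 // ltr_pwDl.
have gkg : 0 <= (k - g) * g.
  rewrite -(pmulr_rge0 _ k2) mulrA -gb -mulrA mulr_ge0 //.
  by rewrite -expr2 sqr_ge0.
pose e := g - k; have [V0 V0E] : exists V0, V0 = 1 + k by exists (1 + k).
have V00 : 0 < V0 by rewrite V0E; lra.
have V0g : 0 < V0 - g.
  rewrite V0E; have [kp|kn] := ltP 0 k.
    have gp : 0 < g by move: gk; rewrite pmulr_lgt0.
    by move: gkg; rewrite pmulr_lge0 //; lra.
  have kn' : k < 0 by rewrite lt_neqAle k0.
  have : g < 0 by move: gk; rewrite nmulr_lgt0.
  lra.
have s0 : - (k * ((e - 1) * (2 * e - k))) < 0.
  rewrite oppr_lt0 /e; have [kp|kn] := ltP 0 k.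
    have gp : 0 < g by move: gk; rewrite pmulr_lgt0.
    move: gkg; rewrite pmulr_lge0 // => gk'.
    by rewrite pmulr_rgt0 // nmulr_lgt0; lra.
  have kn' : k < 0 by rewrite lt_neqAle k0.
  have gn : g < 0 by move: gk; rewrite nmulr_lgt0.
  move: gkg; rewrite nmulr_lge0 // => gk'.
  by rewrite nmulr_rgt0 // nmulr_rlt0; lra.
pose XV : {poly R} := 'X + V0%:P.
pose D := cubic_disc (a *: XV) ((3 * a) *: XV - XV) ((3 * a) *: XV - XV - (1 + b)%:P)
  (a *: XV - 1).
have DE (v : R) (U := v + V0) : D.[v] =
    cubic_disc (a * U) (3 * a * U - U) (3 * a * U - U - 1 - b) (a * U - 1).
  rewrite /D horner_cubic_disc.
  by congr cubic_disc; rewrite /XV !hornerE /U //; ring.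
have D0 : D.[0] < 0.
  rewrite DE add0r.
  have V0n : V0 != 0 by rewrite gt_eqF.
  (* At v = 0 the factors are T = g - V0, S = k - 2 and P = 1 / V0, hence U P = 1 there. *)
  have -> : 3 * a * V0 - V0 - 1 - b = a * V0 * (V0^-1 + (g - V0) * (k - 2)).
    rewrite bE aE; move: V0n; rewrite V0E => V0n; field; by rewrite V0n.
  have -> : 3 * a * V0 - V0 = - (a * V0 * ((g - V0) + (k - 2))).
    by rewrite V0E aE; field.
  have -> : a * V0 - 1 = - (a * V0 * ((g - V0) * V0^-1)).
    by rewrite aE; field; rewrite V0n.
  rewrite cubic_disc_factors.
  have -> : (k - 2) ^+ 2 - 4 * V0^-1 = - (k ^+ 2 * (3 - k) / V0).
    by move: V0n; rewrite V0E => V0n; field.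
  have h3 : 0 < k ^+ 2 * (3 - k) by rewrite mulr_gt0 // subr_gt0.
  have q0 : 0 < (g - V0) ^+ 2 - (k - 2) * (g - V0) + V0^-1.
    have -> : (g - V0) ^+ 2 - (k - 2) * (g - V0) + V0^-1
      = (g - V0 - (k - 2) / 2) ^+ 2 + k ^+ 2 * (3 - k) / (4 * V0).
      by move: V0n; rewrite V0E => V0n; field.
    by rewrite ltr_wpDl ?sqr_ge0 // divr_gt0 // mulr_gt0 ?ltr0n.
  rewrite mulrN mulNr oppr_lt0; apply: mulr_gt0; last exact: exprn_gt0.
  apply: mulr_gt0; last exact: divr_gt0.
  by rewrite exprn_even_gt0 //= mulf_neq0.
(* The cofactor in a [cub](g - U) = a^2 v s(v), where [cub] is [crit] at 1 + x. As s(0) < 0, the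
   product is positive for small negative v; the bound on v also keeps U positive and above g. *)
pose s : {poly R} := (- (k * ((e - 1) * (2 * e - k))))%:P
  + (3 * V0 * e - 3 * e ^+ 2 + g * (e + (g - 2 * V0))) *: 'X
  + (3 * e - V0 - g) *: 'X^2 - 'X^3.
have [||v [v1 v2 sv Dv]] := @horner_neg_near s D 0 (Num.min V0 (V0 - g)) _ _ D0.
- by rewrite lt_min V00.
- suff -> : s.[0] = - (k * ((e - 1) * (2 * e - k))) by [].
  by rewrite /s !(hornerD, hornerN, hornerZ, hornerXn, hornerX, hornerC); ring.
pose U := v + V0.
move: v1; rewrite sub0r ltrNl lt_min => /andP[v1 v3].
have U0 : 0 < U by rewrite /U; lra.
have U4 : U < 4 by rewrite /U V0E; lra.
have Ug : 0 < U - g by rewrite /U; lra.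
have c3 : a * U != 0 by rewrite mulf_neq0 // gt_eqF.
pose cub := Poly [:: a * U - 1; 3 * a * U - U - 1 - b; 3 * a * U - U; a * U].
have cubE (x : R) : cub.[x] = a * U * x ^+ 3 + (3 * a * U - U) * x ^+ 2
   + (3 * a * U - U - 1 - b) * x + (a * U - 1) by rewrite /cub horner_Poly /=; ring.
have a2 : 0 < a ^+ 2 by rewrite exprn_even_gt0.
have G : 0 < a * cub.[g - U].
  have -> : a * cub.[g - U] = a ^+ 2 * (v * s.[v]).
    rewrite cubE bE aE /s !(hornerD, hornerN, hornerZ, hornerXn, hornerX, hornerC).
    by rewrite /e /U V0E; field.
  by rewrite pmulr_rgt0 // nmulr_rgt0.
have [T rT] : {T | root cub T}.
  by apply: odd_poly_root; rewrite /cub (@PolyK _ 0).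
pose S := - ((3 * a * U - U) / (a * U)) - T.
pose P := (3 * a * U - U - 1 - b) / (a * U) - T * S.
have f1 : 3 * a * U - U = - (a * U * (T + S)).
  have -> : T + S = - ((3 * a * U - U) / (a * U)) by rewrite /S; ring.
  by rewrite mulrN opprK [RHS]mulrC divfK.
have f2 : 3 * a * U - U - 1 - b = a * U * (P + T * S).
  have -> : P + T * S = (3 * a * U - U - 1 - b) / (a * U) by rewrite /P; ring.
  by rewrite [RHS]mulrC divfK.
have f3 : a * U - 1 = - (a * U * (T * P)).
  move/rootP: rT; rewrite cubE f2 f1 => /eqP; rewrite addrC addr_eq0 => /eqP ->.
  by ring.
have SP : S ^+ 2 < 4 * P.
  move: Dv; rewrite DE -/U f2 f1 f3 cubic_disc_factors => h.
  rewrite ltNge; apply/negP => le; move: h; rewrite ltNge mulr_ge0 ?sqr_ge0 //.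
  by rewrite mulr_ge0 ?subr_ge0 // exprn_even_ge0.
have quad (x : R) : 0 < x ^+ 2 - S * x + P.
  by have : 0 <= (2 * x - S) ^+ 2; [exact: sqr_ge0 | nra].
(* T is the only real root of [cub], so the sign at g - U locates it. With U - g = U P (- T) this
   yields U P < 1. *)
have TU : T < g - U.
  move: G; rewrite cubE f2 f1 f3.
  have -> : a * (a * U * (g - U) ^+ 3 + - (a * U * (T + S)) * (g - U) ^+ 2
     + a * U * (P + T * S) * (g - U) + - (a * U * (T * P)))
     = (g - U - T) * ((a ^+ 2 * U) * ((g - U) ^+ 2 - S * (g - U) + P)) by ring.
  by rewrite pmulr_lgt0 ?subr_gt0 //; apply: mulr_gt0 => //; apply: mulr_gt0.
exists U, T, S, P; split=> //; first by rewrite U0.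
have P0 : 0 < P by have : 0 <= S ^+ 2; [exact: sqr_ge0 | lra].
have : U - g = U * P * (- T).
  apply: (mulfI a0); rewrite mulrBr ag f3; ring.
move=> h; rewrite -(ltr_pM2l Ug) mulr1.
rewrite {2}h mulrC ltr_pM2l ?mulr_gt0 //; lra.
Qed.

End Violation.

(** * A Laguerre-type bound away from the roots *)

Section Laguerre.
Variable K : numFieldType.

(* [(q' ^ 2 - q q'') / q ^ 2] is the sum of the [(w - x) ^- 2] over the roots [x] of [q]. *)
Lemma laguerre_bound (w h c : K) (s : seq K) (q := c *: \prod_(x <- s) ('X - x%:P)) :
  0 < h -> all (fun x => h <= `|w - x|) s ->
  `|q^`()^`().[w] * q.[w] - q^`().[w] ^+ 2| * h ^+ 2 <= (size s)%:R * `|q.[w]| ^+ 2.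
Proof.
move=> h0 hs; rewrite {}/q.
elim: s hs => [_|x s IH /andP[hx /IH {}IH]].
  by rewrite big_nil alg_polyC !derivC !horner0 mul0r expr0n subrr normr0 mul0r /= mul0r.
rewrite big_cons; set q := \prod_(_ <- _) _ in IH *.
rewrite scalerAr; move: (c *: q) IH => {}q IH.
set q0 := q.[w] in IH *; set q1 := q^`().[w] in IH *; set q2 := q^`()^`().[w] in IH *.
have d0 : (('X - x%:P) * q).[w] = (w - x) * q0.
  by rewrite hornerM hornerXsubC.
have d1 : (('X - x%:P) * q)^`().[w] = q0 + (w - x) * q1.
  by rewrite derivM derivXsubC mul1r hornerD hornerM hornerXsubC.
have d2 : (('X - x%:P) * q)^`()^`().[w] = q1 + q1 + (w - x) * q2.
  rewrite derivM derivXsubC mul1r derivD derivM derivXsubC mul1r.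
  by rewrite !hornerD hornerM hornerXsubC addrA.
rewrite d0 d1 d2.
have -> : (q1 + q1 + (w - x) * q2) * ((w - x) * q0) - (q0 + (w - x) * q1) ^+ 2
  = (w - x) ^+ 2 * (q2 * q0 - q1 ^+ 2) - q0 ^+ 2 by ring.
have wx0 : 0 <= `|w - x| ^+ 2 by rewrite exprn_ge0.
apply: le_trans (ler_wpM2r _ (ler_normB _ _)) _; first by rewrite exprn_ge0 // ltW.
rewrite mulrDl normrM !normrX normrM -mulrA.
have -> : (size (x :: s))%:R * (`|w - x| * `|q0|) ^+ 2
  = `|w - x| ^+ 2 * ((size s)%:R * `|q0| ^+ 2) + `|q0| ^+ 2 * `|w - x| ^+ 2.
  by rewrite /= -natr1; ring.
apply: lerD; first exact: ler_wpM2l.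
by rewrite ler_wpM2l ?exprn_ge0 // lerXn2r ?nnegrE ?(ltW h0).
Qed.

End Laguerre.

(** * Closed forms for P_m and its first two derivatives *)

Section Recurrence.
Variable K : fieldType.
Implicit Types (x y z al w : K) (E : nat -> K).

(** The coefficient of x^m in the closed form, fitted to the first three terms. *)
Definition binet_coef E x y z :=
  (E 2 - (y + z) * E 1%N + y * z * E 0%N) / ((x - y) * (x - z)).

Lemma binet E x y z : x != y -> x != z -> y != z ->
  (forall m, E m.+3 = (x + y + z) * E m.+2 - (x * y + x * z + y * z) * E m.+1
     + x * y * z * E m) ->
  forall m, E m = binet_coef E x y z * x ^+ m + binet_coef E y x z * y ^+ m
     + binet_coef E z x y * z ^+ m.
Proof.
move=> xy xz yz rec.
have nz : [&& x - y != 0, x - z != 0, y - x != 0, y - z != 0, z - x != 0 & z - y != 0].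
  by rewrite !subr_eq0 xy xz yz ![z == _]eq_sym [y == x]eq_sym xy xz yz.
move: nz => /andP[n1 /and5P[n2 n3 n4 n5 n6]].
elim/ltn_ind => -[|[|[|m]]] IH; rewrite /binet_coef.
- by field; rewrite n1 n2 n3 n4 n5 n6.
- by field; rewrite n1 n2 n3 n4 n5 n6.
- by field; rewrite n1 n2 n3 n4 n5 n6.
rewrite -!/(binet_coef _ _ _ _) rec (IH m.+2) // (IH m.+1) ?ltnS ?leqnSn //.
rewrite (IH m) ?ltnS 1?ltnW //.
by rewrite !exprS; ring.
Qed.

Section Roots.
Variables (a b w x y z : K).
Hypothesis e1 : x + y + z = -1.
Hypothesis e2 : x * y + x * z + y * z = a - b * w.
Hypothesis e3 : x * y * z = - w.
Hypotheses (xy : x != y) (xz : x != z) (yz : y != z).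
Hypotheses (x0 : x != 0) (y0 : y != 0) (z0 : z != 0).

Definition lin_op E m := E m.+3 + E m.+2 + (a - b * w) * E m.+1 + w * E m.

Lemma binet_lin_op E : (forall m, lin_op E m = 0) ->
  forall m, E m = binet_coef E x y z * x ^+ m + binet_coef E y x z * y ^+ m
     + binet_coef E z x y * z ^+ m.
Proof.
move=> rec; apply: binet => // m; rewrite e1 e2 e3; apply/eqP.
by rewrite -subr_eq0 -(rec m) /lin_op; apply/eqP; ring.
Qed.

(** Times x^m, this is the contribution of x to h_m(x, y, z). *)
Definition Q_coef x y z : K := x ^+ 2 / ((x - y) * (x - z)).
(** x' / x for the root x as a function of w, by implicit differentiation of x^3 + x^2 + (a - b w) x
    + w = 0. *)
Definition log_slope x y z : K := (b * x - 1) / (x * ((x - y) * (x - z))).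

Let A1 := Q_coef x y z.
Let A2 := Q_coef y x z.
Let A3 := Q_coef z x y.
Let l1 := log_slope x y z.
Let l2 := log_slope y x z.
Let l3 := log_slope z x y.
Let q m : K := (Qm a b m).[w].
Let q' m : K := (Qm a b m)^`().[w].
Let q'' m : K := (Qm a b m)^`()^`().[w].

Lemma Qm_binet m : q m = A1 * x ^+ m + A2 * y ^+ m + A3 * z ^+ m.
Proof.
rewrite (@binet_lin_op q); last by move=> n; rewrite /lin_op /q horner_QmS3; ring.
have q0 : q 0%N = 1 by rewrite /q horner_Qm0.
have q1 : q 1%N = x + y + z by rewrite /q horner_Qm1.
have q2 : q 2 = (x + y + z) ^+ 2 - (x * y + x * z + y * z).
  by rewrite /q horner_Qm2 e1 e2; ring.
have E x1 y1 z1 : x1 + y1 + z1 = x + y + z ->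
    x1 * y1 + x1 * z1 + y1 * z1 = x * y + x * z + y * z ->
    binet_coef q x1 y1 z1 = Q_coef x1 y1 z1.
  move=> h1 h2; rewrite /binet_coef /Q_coef; congr (_ / _).
  by rewrite q0 q1 q2 -h1 -h2; ring.
by rewrite /A1 /A2 /A3 !E //; ring.
Qed.

Lemma lin_op_deriv m : lin_op q' m = b * q m.+1 - q m.
Proof.
rewrite /lin_op /q' /q QmS3 !(derivB, derivN, derivM, derivC, derivZ, derivX).
rewrite !(hornerD, hornerN, hornerM, hornerC, hornerZ, hornerX); ring.
Qed.

Lemma lin_op_deriv2 m : lin_op q'' m = 2 * (b * q' m.+1 - q' m).
Proof.
rewrite /lin_op /q'' /q' QmS3.
rewrite !(derivD, derivN, derivM, derivC, derivZ, derivX, deriv0, derivZ).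
rewrite !(hornerD, hornerN, hornerM, hornerC, hornerZ, hornerX, horner0); ring.
Qed.

Lemma char_root v : [\/ v = x, v = y | v = z] ->
  v ^+ 3 + v ^+ 2 + (a - b * w) * v + w = 0.
Proof.
move=> hv; transitivity ((v - x) * (v - y) * (v - z)).
  rewrite -e2 -[w]opprK -e3.
  transitivity (v ^+ 3 - (-1) * v ^+ 2 + (x * y + x * z + y * z) * v + - (x * y * z)).
    by ring.
  by rewrite -e1; ring.
by case: hv => ->; rewrite subrr ?mulr0 ?mul0r.
Qed.

(** Resonance: at a characteristic root the terms with a factor m cancel, and the derivative of the
    characteristic polynomial remains. *)
Lemma lin_op_lin (c v : K) m : v ^+ 3 + v ^+ 2 + (a - b * w) * v + w = 0 ->
  lin_op (fun n => c * n%:R * v ^+ n) m =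
  c * v ^+ m.+1 * (3 * v ^+ 2 + 2 * v + (a - b * w)).
Proof.
move=> hv; rewrite /lin_op -[RHS]addr0 -(mulr0 (c * m%:R * v ^+ m)) -hv !exprS -!natr1.
by ring.
Qed.

Lemma lin_op_quad (c v : K) m : v ^+ 3 + v ^+ 2 + (a - b * w) * v + w = 0 ->
  lin_op (fun n => c * n%:R ^+ 2 * v ^+ n) m =
  c * v ^+ m * (2 * m%:R * (v * (3 * v ^+ 2 + 2 * v + (a - b * w)))
    + (9 * v ^+ 3 + 4 * v ^+ 2 + (a - b * w) * v)).
Proof.
move=> hv; rewrite /lin_op -[RHS]addr0 -(mulr0 (c * m%:R ^+ 2 * v ^+ m)) -hv !exprS -!natr1.
by ring.
Qed.

Lemma lin_opD E F m : lin_op (fun n => E n + F n) m = lin_op E m + lin_op F m.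
Proof. by rewrite /lin_op; ring. Qed.

Lemma lin_opB E F m : lin_op (fun n => E n - F n) m = lin_op E m - lin_op F m.
Proof. by rewrite /lin_op; ring. Qed.

Lemma char_deriv u v t : u + v + t = -1 -> u * v + u * t + v * t = a - b * w ->
  3 * u ^+ 2 + 2 * u + (a - b * w) = (u - v) * (u - t).
Proof.
move=> h1 <-; transitivity (3 * u ^+ 2 - 2 * (-1) * u + (u * v + u * t + v * t)); first by ring.
by rewrite -h1; ring.
Qed.

(** The differentiated recurrence has a resonant right-hand side, absorbed by the terms A l m x^m
    that d/dw x^m = m l x^m suggests. What remains solves the homogeneous recurrence. *)
Lemma Qm_deriv_binet : exists B1 B2 B3 : K, forall m,
  q' m = (A1 * l1 * m%:R + B1) * x ^+ m + (A2 * l2 * m%:R + B2) * y ^+ m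
       + (A3 * l3 * m%:R + B3) * z ^+ m.
Proof.
pose M m := A1 * l1 * m%:R * x ^+ m + A2 * l2 * m%:R * y ^+ m + A3 * l3 * m%:R * z ^+ m.
have hx := char_root (Or31 _ _ (erefl x)); have hy := char_root (Or32 _ _ (erefl y)).
have hz := char_root (Or33 _ _ (erefl z)).
have dx := char_deriv e1 e2.
have dy := @char_deriv y x z ltac:(rewrite -e1; ring) ltac:(rewrite -e2; ring).
have dz := @char_deriv z x y ltac:(rewrite -e1; ring) ltac:(rewrite -e2; ring).
have h m : lin_op (fun n => q' n - M n) m = 0.
  rewrite lin_opB lin_op_deriv /M !lin_opD !lin_op_lin // dx dy dz !Qm_binet.
  rewrite /l1 /l2 /l3 /log_slope !exprS; field.
  by rewrite !subr_eq0 x0 y0 z0 xy xz yz ![z == _]eq_sym [y == x]eq_sym xy xz yz.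
have [B1 [B2 [B3 hB]]] : exists B1 B2 B3, forall m, q' m - M m =
    B1 * x ^+ m + B2 * y ^+ m + B3 * z ^+ m.
  by do 3 eexists; exact: binet_lin_op h.
by exists B1, B2, B3 => m; rewrite -[LHS](subrK (M m)) hB /M; ring.
Qed.

Lemma Qm_deriv2_binet : exists B1 B2 B3 C1 C2 C3 D1 D2 D3 : K, forall m,
  q' m = (A1 * l1 * m%:R + B1) * x ^+ m + (A2 * l2 * m%:R + B2) * y ^+ m
       + (A3 * l3 * m%:R + B3) * z ^+ m /\
  q'' m = (A1 * l1 ^+ 2 * m%:R ^+ 2 + C1 * m%:R + D1) * x ^+ m
        + (A2 * l2 ^+ 2 * m%:R ^+ 2 + C2 * m%:R + D2) * y ^+ m
        + (A3 * l3 ^+ 2 * m%:R ^+ 2 + C3 * m%:R + D3) * z ^+ m.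
Proof.
have [B1 [B2 [B3 hB]]] := Qm_deriv_binet.
(* The coefficient of m v^m, solved from the terms without a factor m. *)
pose G v A l B := (2 * (b * A * l * v + B * (b * v - 1))
   - A * l ^+ 2 * (9 * v ^+ 3 + 4 * v ^+ 2 + (a - b * w) * v))
   / (v * (3 * v ^+ 2 + 2 * v + (a - b * w))).
pose C1 := G x A1 l1 B1; pose C2 := G y A2 l2 B2; pose C3 := G z A3 l3 B3.
pose M m := A1 * l1 ^+ 2 * m%:R ^+ 2 * x ^+ m + A2 * l2 ^+ 2 * m%:R ^+ 2 * y ^+ m
  + A3 * l3 ^+ 2 * m%:R ^+ 2 * z ^+ m
  + (C1 * m%:R * x ^+ m + C2 * m%:R * y ^+ m + C3 * m%:R * z ^+ m).
have hx := char_root (Or31 _ _ (erefl x)); have hy := char_root (Or32 _ _ (erefl y)).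
have hz := char_root (Or33 _ _ (erefl z)).
have dx := char_deriv e1 e2.
have dy := @char_deriv y x z ltac:(rewrite -e1; ring) ltac:(rewrite -e2; ring).
have dz := @char_deriv z x y ltac:(rewrite -e1; ring) ltac:(rewrite -e2; ring).
have part v A l B c m : v != 0 -> l * (v * c) = b * v - 1 -> c != 0 ->
    c = 3 * v ^+ 2 + 2 * v + (a - b * w) ->
    A * l ^+ 2 * v ^+ m * (2 * m%:R * (v * c) + (9 * v ^+ 3 + 4 * v ^+ 2 + (a - b * w) * v))
    + G v A l B * v ^+ m.+1 * c
    = 2 * (b * ((A * l * m.+1%:R + B) * v ^+ m.+1) - (A * l * m%:R + B) * v ^+ m).
  move=> v0 hl c0 hc.
  have -> : G v A l B * v ^+ m.+1 * c = (2 * (b * A * l * v + B * (b * v - 1))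
   - A * l ^+ 2 * (9 * v ^+ 3 + 4 * v ^+ 2 + (a - b * w) * v)) * v ^+ m.
    by rewrite /G -hc [v ^+ m.+1]exprS; field; rewrite v0 c0.
  transitivity (v ^+ m * (2 * m%:R * A * l * (l * (v * c))
    + 2 * (b * A * l * v + B * (b * v - 1)))); first by ring.
  by rewrite hl [v ^+ m.+1]exprS -natr1; ring.
have h m : lin_op (fun n => q'' n - M n) m = 0.
  rewrite lin_opB lin_op_deriv2 /M !lin_opD !lin_op_lin // !lin_op_quad // dx dy dz !hB.
  have px := part x A1 l1 B1 ((x - y) * (x - z)) m x0.
  have py := part y A2 l2 B2 ((y - x) * (y - z)) m y0.
  have pz := part z A3 l3 B3 ((z - x) * (z - y)) m z0.
  have ls (u v t : K) : u != 0 -> u != v -> u != t ->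
      log_slope u v t * (u * ((u - v) * (u - t))) = b * u - 1.
    by move=> u0 uv ut; rewrite /log_slope divfK // !mulf_neq0 ?subr_eq0.
  apply/eqP; rewrite subr_eq0; apply/eqP.
  transitivity (2 * (b * ((A1 * l1 * m.+1%:R + B1) * x ^+ m.+1) - (A1 * l1 * m%:R + B1) * x ^+ m)
  + 2 * (b * ((A2 * l2 * m.+1%:R + B2) * y ^+ m.+1) - (A2 * l2 * m%:R + B2) * y ^+ m)
  + 2 * (b * ((A3 * l3 * m.+1%:R + B3) * z ^+ m.+1) - (A3 * l3 * m%:R + B3) * z ^+ m)).
    by ring.
  rewrite -px -?py -?pz ?ls ?mulf_neq0 ?subr_eq0 // 1?eq_sym // 1?eq_sym // /C1 /C2 /C3.
  by ring.
have [D1 [D2 [D3 hD]]] : exists D1 D2 D3, forall m, q'' m - M m =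
    D1 * x ^+ m + D2 * y ^+ m + D3 * z ^+ m.
  by do 3 eexists; exact: binet_lin_op h.
exists B1, B2, B3, C1, C2, C3, D1, D2, D3 => m; split=> //.
by rewrite -[LHS](subrK (M m)) hD /M; ring.
Qed.

End Roots.
End Recurrence.

(** * A real-valued modulus for complex numbers *)

Section Modulus.
Variable R : rcfType.
Local Notation C := (complex R).
Implicit Types z : C.

(* The norm of [complex R] takes values in [complex R]; this one is real. *)
Definition cabs (z : C) : R := complex.Re `|z|.

Lemma normr_cabs z : `|z| = (cabs z)%:C%C.
Proof. by rewrite /cabs RRe_real ?normr_real. Qed.

Lemma cabs_ge0 z : 0 <= cabs z.
Proof. by rewrite -ler0c -normr_cabs. Qed.

Lemma cabsM z1 z2 : cabs (z1 * z2) = cabs z1 * cabs z2.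
Proof. by apply: complexI; rewrite rmorphM -!normr_cabs normrM. Qed.

Lemma cabsX z n : cabs (z ^+ n) = cabs z ^+ n.
Proof. by apply: complexI; rewrite rmorphXn -!normr_cabs normrX. Qed.

Lemma cabsN z : cabs (- z) = cabs z.
Proof. by apply: complexI; rewrite -!normr_cabs normrN. Qed.

Lemma cabsV z : cabs z^-1 = (cabs z)^-1.
Proof. by apply: complexI; rewrite fmorphV -!normr_cabs normfV. Qed.

Lemma cabsD z1 z2 : cabs (z1 + z2) <= cabs z1 + cabs z2.
Proof. by rewrite -lecR rmorphD -!normr_cabs ler_normD. Qed.

Lemma cabsB z1 z2 : cabs (z1 - z2) <= cabs z1 + cabs z2.
Proof. by rewrite -(cabsN z2) cabsD. Qed.

Lemma cabs_nat n : cabs n%:R = n%:R.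
Proof. by apply: complexI; rewrite rmorph_nat -normr_cabs normr_nat. Qed.

Lemma cabs_eq0 z : (cabs z == 0) = (z == 0).
Proof.
by rewrite -(inj_eq (@complexI R)) rmorph0 -normr_cabs normr_eq0.
Qed.

Lemma cabs_gt0 z : (0 < cabs z) = (z != 0).
Proof. by rewrite lt0r cabs_eq0 cabs_ge0 andbT. Qed.

Lemma cabsE z : cabs z = Num.sqrt (complex.Re z ^+ 2 + complex.Im z ^+ 2).
Proof. by apply: complexI; rewrite -normr_cabs normc_def. Qed.

Lemma Im_le_cabs z : `|complex.Im z| <= cabs z.
Proof. by rewrite cabsE -sqrtr_sqr ler_wsqrtr // lerDr sqr_ge0. Qed.

Lemma lin_bound (c1 c2 c3 x y z : C) (N : R) :
  cabs x <= N -> cabs y <= N -> cabs z <= N ->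
  cabs (c1 * x + c2 * y + c3 * z) <= (cabs c1 + cabs c2 + cabs c3) * N.
Proof.
move=> hx hy hz; apply: le_trans (cabsD _ _) _; apply: le_trans (lerD (cabsD _ _) (lexx _)) _.
by rewrite !cabsM !mulrDl !lerD // ler_wpM2l ?cabs_ge0.
Qed.

End Modulus.

(** * Growth under two equally dominant roots *)

Section Growth.
Variable R : archiRcfType.
Local Notation C := (complex R).

Lemma nat_mul_bounded (r M : R) : (forall m : nat, m.+1%:R * r <= M) -> r <= 0.
Proof.
move=> h; rewrite leNgt; apply/negP => r0.
have := h (Num.truncn (M / r)); have := truncnS_gt (M / r).
by rewrite ltr_pdivrMr // => /lt_le_trans/[apply]; rewrite ltxx.
Qed.

(** With s = |y| and s + d = |x| it gives m |y|^m = O(|x|^m) with an explicit constant. *)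
Lemma nat_mul_exp (s d : R) m : 0 <= s -> 0 <= d ->
  m%:R * d * s ^+ m <= s * (s + d) ^+ m.
Proof.
move=> s0 d0; elim: m => [|m IH]; first by rewrite !mul0r expr0 mulr1.
have h : s ^+ m <= (s + d) ^+ m by rewrite lerXn2r ?nnegrE ?addr_ge0 // lerDl.
have h1 : s * (m%:R * d * s ^+ m) <= s * (s * (s + d) ^+ m) by rewrite ler_wpM2l.
have h2 : s * d * s ^+ m <= s * d * (s + d) ^+ m by rewrite ler_wpM2l // mulr_ge0.
rewrite !exprS -natr1; move: (s ^+ m) ((s + d) ^+ m) h1 h2 => u v h1 h2.
have -> : (m%:R + 1) * d * (s * u) = s * (m%:R * d * u) + s * d * u by ring.
have -> : s * ((s + d) * v) = s * (s * v) + s * d * v by ring.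
exact: lerD.
Qed.

(* [q], [q'] and [q''] play the role of P_m and its derivatives: if the two dominant
   exponentials have equal modulus then [q'' q - q' ^ 2] has size m^2 |q|^2. *)
Lemma equimodular_growth (x y z A1 A2 A3 l1 l2 l3 B1 B2 B3 C1 C2 C3 D1 D2 D3 : C)
    (q q' q'' : nat -> C) (M : R) :
  x != 0 -> cabs z = cabs x -> cabs y < cabs x -> 0 <= M ->
  (forall m, q m = A1 * x ^+ m + A2 * y ^+ m + A3 * z ^+ m) ->
  (forall m, q' m = (A1 * l1 * m%:R + B1) * x ^+ m + (A2 * l2 * m%:R + B2) * y ^+ m
       + (A3 * l3 * m%:R + B3) * z ^+ m) ->
  (forall m, q'' m = (A1 * l1 ^+ 2 * m%:R ^+ 2 + C1 * m%:R + D1) * x ^+ m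
        + (A2 * l2 ^+ 2 * m%:R ^+ 2 + C2 * m%:R + D2) * y ^+ m
        + (A3 * l3 ^+ 2 * m%:R ^+ 2 + C3 * m%:R + D3) * z ^+ m) ->
  (forall m, cabs (q'' m * q m - q' m ^+ 2) <= m%:R * M * cabs (q m) ^+ 2) ->
  A1 * A3 * (l1 - l3) ^+ 2 = 0.
Proof.
move=> x0 hz hy M0 qE qE' qE'' bound.
apply/eqP; rewrite -cabs_eq0 eq_le cabs_ge0 andbT.
pose c12 := A1 * A2 * (l1 - l2) ^+ 2; pose c23 := A2 * A3 * (l2 - l3) ^+ 2.
set c13 := A1 * A3 * _.
have d0 : 0 < cabs x - cabs y by rewrite subr_gt0.
pose k := cabs y / (cabs x - cabs y).
pose SA := cabs A1 + cabs A2 + cabs A3.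
pose SL := cabs (A1 * l1) + cabs (A2 * l2) + cabs (A3 * l3).
pose SB := cabs B1 + cabs B2 + cabs B3.
pose SC := cabs C1 + cabs C2 + cabs C3.
pose SD := cabs D1 + cabs D2 + cabs D3.
apply: (@nat_mul_bounded _ (M * SA ^+ 2 + k * (cabs c12 + cabs c23)
  + (SC * SA + 2 * (SL * SB)) + (SD * SA + SB ^+ 2))) => n.
set m := n.+1; pose N := cabs x ^+ m.
have N0 : 0 < N by rewrite exprn_gt0 // cabs_gt0.
have hX : cabs (x ^+ m) = N by rewrite cabsX.
have hZ : cabs (z ^+ m) = N by rewrite cabsX hz.
have hY : cabs (y ^+ m) <= N by rewrite cabsX lerXn2r ?nnegrE ?cabs_ge0 // ltW.
have hmY : m%:R * cabs (y ^+ m) <= k * N.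
  have := @nat_mul_exp (cabs y) (cabs x - cabs y) m (cabs_ge0 _) (ltW d0).
  rewrite subrKC cabsX -/N => h.
  rewrite /k mulrAC ler_pdivlMr //; apply: le_trans h; rewrite le_eqVlt.
  by apply/orP; left; apply/eqP; ring.
have {}bound := bound m; rewrite qE qE' qE'' in bound.
move: (x ^+ m) (y ^+ m) (z ^+ m) hX hY hZ hmY bound => X Y Z hX hY hZ hmY bound.
have lb c1 c2 c3 : cabs (c1 * X + c2 * Y + c3 * Z) <= (cabs c1 + cabs c2 + cabs c3) * N.
  by apply: lin_bound; rewrite ?hX ?hZ.
set D := _ - _ in bound.
pose LA := A1 * X + A2 * Y + A3 * Z; pose LB := B1 * X + B2 * Y + B3 * Z.
pose LC := C1 * X + C2 * Y + C3 * Z; pose LD := D1 * X + D2 * Y + D3 * Z.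
pose LL := A1 * l1 * X + A2 * l2 * Y + A3 * l3 * Z.
(* The m^2 part is the sum over pairs of A_i A_j (l_i - l_j)^2 X_i X_j. The pairs containing Y are
   of order m because m Y = O(N), so only the pair X, Z is left at order m^2. *)
have DE : m%:R ^+ 2 * (c13 * X * Z) = D - m%:R * (m%:R * Y) * (c12 * X + c23 * Z)
   - m%:R * (LC * LA - 2 * (LL * LB)) - (LD * LA - LB ^+ 2).
  by rewrite /D /c13 /c12 /c23 /LA /LB /LC /LD /LL; ring.
have hD : cabs D <= m%:R * (M * SA ^+ 2 * N ^+ 2).
  apply: le_trans bound _; rewrite -mulrA ler_wpM2l ?ler0n // -mulrA ler_wpM2l //.
  by rewrite -exprMn lerXn2r ?nnegrE ?cabs_ge0 ?mulr_ge0 ?addr_ge0 ?cabs_ge0 // ltW.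
have sge0 c1 c2 c3 : 0 <= (cabs c1 + cabs c2 + cabs c3 : R).
  by rewrite !addr_ge0 ?cabs_ge0.
have prod u v su sv : cabs u <= su * N -> cabs v <= sv * N ->
    cabs (u * v) <= su * sv * N ^+ 2.
  move=> hu hv; rewrite cabsM.
  have -> : su * sv * N ^+ 2 = (su * N) * (sv * N) by ring.
  by rewrite ler_pM ?cabs_ge0.
have h2 : cabs (m%:R * (m%:R * Y) * (c12 * X + c23 * Z))
   <= m%:R * (k * (cabs c12 + cabs c23) * N ^+ 2).
  rewrite -mulrA cabsM cabs_nat ler_wpM2l ?ler0n //; apply: prod.
    by rewrite cabsM cabs_nat.
  by apply: le_trans (cabsD _ _) _; rewrite !cabsM hX hZ -mulrDl.
have h3 : cabs (m%:R * (LC * LA - 2 * (LL * LB))) <= m%:R * ((SC * SA + 2 * (SL * SB)) * N ^+ 2).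
  rewrite cabsM cabs_nat ler_wpM2l ?ler0n //; apply: le_trans (cabsB _ _) _.
  rewrite [leRHS]mulrDl lerD //; first by apply: prod; apply: lb.
  by rewrite cabsM cabs_nat -mulrA ler_wpM2l ?ler0n //; apply: prod; apply: lb.
have h4 : cabs (LD * LA - LB ^+ 2) <= (SD * SA + SB ^+ 2) * N ^+ 2.
  apply: le_trans (cabsB _ _) _; rewrite [leRHS]mulrDl lerD //; first by apply: prod; apply: lb.
  by rewrite !expr2; apply: prod; apply: lb.
have h4' : cabs (LD * LA - LB ^+ 2) <= m%:R * ((SD * SA + SB ^+ 2) * N ^+ 2).
  apply: le_trans h4 _; rewrite ler_peMl ?ler1n //.
  by rewrite mulr_ge0 ?sqr_ge0 //; apply: addr_ge0; rewrite ?sqr_ge0 //;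
     apply: mulr_ge0; apply: sge0.
have m0 : 0 < m%:R * N ^+ 2 :> R by rewrite mulr_gt0 ?ltr0n // exprn_gt0.
rewrite -(ler_pM2l m0).
have -> : m%:R * N ^+ 2 * (m%:R * cabs c13) = cabs (m%:R ^+ 2 * (c13 * X * Z)).
  by rewrite !cabsM !cabs_nat hX hZ; ring.
rewrite DE; apply: le_trans (cabsB _ _) _.
apply: le_trans (lerD (le_trans (cabsB _ _) (lerD (cabsB _ _) (lexx _))) (lexx _)) _.
have -> : m%:R * N ^+ 2 * (M * SA ^+ 2 + k * (cabs c12 + cabs c23)
  + (SC * SA + 2 * (SL * SB)) + (SD * SA + SB ^+ 2))
  = m%:R * (M * SA ^+ 2 * N ^+ 2) + m%:R * (k * (cabs c12 + cabs c23) * N ^+ 2)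
   + m%:R * ((SC * SA + 2 * (SL * SB)) * N ^+ 2) + m%:R * ((SD * SA + SB ^+ 2) * N ^+ 2).
  by ring.
by rewrite !lerD.
Qed.

End Growth.

(** * A nonreal w with two dominant roots of equal modulus *)

Section Point.
Variable R : rcfType.
Local Notation C := (complex R).
Local Notation "x %:C" := (real_complex R x).

Lemma conj_char_root (a b : R) (v w : C) : conjc w = w ->
  v ^+ 3 + v ^+ 2 + (a%:C - b%:C * w) * v + w = 0 ->
  conjc v ^+ 3 + conjc v ^+ 2 + (a%:C - b%:C * w) * conjc v + w = 0.
Proof.
move=> cw /(congr1 (@conjc R)); rewrite conjc0 => <-.
rewrite !(rmorphXn, rmorphD, rmorphN, rmorphM).
by congr (_ + _ + (_ - _ * _) * _ + _); rewrite ?cw //; apply/esym/conjc_real.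
Qed.

(** With eta = e^(it), u = 2 cos t the square root of U, and om = z / u a root of x^2 - S x + P, the
    roots are eta, its conjugate and u om, all divided by - u (1 + om). The first two have equal
    modulus, and they dominate since |u om|^2 = U P < 1. *)
Lemma equimodular_point (a b U T S P : R) :
  0 < U < 4 -> S ^+ 2 < 4 * P -> U * P < 1 -> a != 0 -> crit_factors a b U T S P ->
  exists x y z w : C, [/\ [/\ x + y + z = -1, x * y + x * z + y * z = a%:C - b%:C * w
     & x * y * z = - w], [/\ x != 0, y != 0 & x != z],
     cabs z = cabs x /\ cabs y < cabs x,
     log_slope b%:C x y z != log_slope b%:C z x y & complex.Im w != 0].
Proof.
move=> /andP[U0 U4] SP UP a0 [f1 f2 f3].
pose su := Num.sqrt U; pose r := Num.sqrt (1 - U / 4).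
have suE : su ^+ 2 = U by rewrite sqr_sqrtr // ltW.
have rE : r ^+ 2 = 1 - U / 4 by rewrite sqr_sqrtr //; lra.
have r0 : 0 < r by rewrite sqrtr_gt0; lra.
have su0 : 0 < su by rewrite sqrtr_gt0.
pose t := Num.sqrt (P - S ^+ 2 / 4).
have tE : t ^+ 2 = P - S ^+ 2 / 4 by rewrite sqr_sqrtr //; lra.
have t0 : 0 < t by rewrite sqrtr_gt0; lra.
pose eta : C := Complex (su / 2) r; pose eta' : C := Complex (su / 2) (- r).
pose om : C := Complex (S / 2) t; pose u : C := su%:C; pose sg : C := 1 + om.
have etaD : eta + eta' = u.
  by apply/eqP; rewrite eq_complex /= subrr eqxx andbT; apply/eqP; field.
have etaM : eta * eta' = 1.
  apply/eqP; rewrite eq_complex /=; apply/andP; split; apply/eqP; last by ring.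
  by transitivity (su ^+ 2 / 4 + r ^+ 2); [field | rewrite suE rE; ring].
have uE : u ^+ 2 = U%:C by rewrite -rmorphXn suE.
have omE : om ^+ 2 - S%:C * om + P%:C = 0.
  apply/eqP; rewrite eq_complex /=; apply/andP; split; apply/eqP; last by field.
  by transitivity (P - S ^+ 2 / 4 - t ^+ 2); [field | rewrite tE; ring].
have om0 : om != 0 by rewrite eq_complex /= [t == 0]gt_eqF // andbF.
have sg0 : sg != 0 by rewrite eq_complex /= add0r [t == 0]gt_eqF // andbF.
have u0 : u != 0 by rewrite fmorph_eq0 gt_eqF.
have ab_eta : eta != eta'.
  by rewrite eq_complex /= eqxx -subr_eq0 opprK /= gt_eqF // addr_gt0.
have eta0 : eta != 0 by apply: contra_eq_neq etaM => ->; rewrite mul0r eq_sym oner_neq0.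
have g1 : 3 * a%:C * U%:C - U%:C = - (a%:C * U%:C * (T%:C + S%:C)).
  by have := congr1 (real_complex R) f1; rewrite !(rmorphD, rmorphB, rmorphN, rmorphM, rmorph_nat).
have g2 : 3 * a%:C * U%:C - U%:C - 1 - b%:C = a%:C * U%:C * (P%:C + T%:C * S%:C).
  by have := congr1 (real_complex R) f2;
     rewrite !(rmorphD, rmorphB, rmorphN, rmorphM, rmorph_nat, rmorph1).
have g3 : a%:C * U%:C - 1 = - (a%:C * U%:C * (T%:C * P%:C)).
  by have := congr1 (real_complex R) f3; rewrite !(rmorphD, rmorphB, rmorphN, rmorphM, rmorph1).
have cr : crit a%:C b%:C (u ^+ 2) sg = 0.
  rewrite uE; transitivity (a%:C * U%:C * om ^+ 3 + (3 * a%:C * U%:C - U%:C) * om ^+ 2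
    + (3 * a%:C * U%:C - U%:C - 1 - b%:C) * om + (a%:C * U%:C - 1)).
    by rewrite /crit /sg; ring.
  rewrite g2 g1 g3.
  transitivity (a%:C * U%:C * (om - T%:C) * (om ^+ 2 - S%:C * om + P%:C)); first by ring.
  by rewrite omE mulr0.
(* Simplicity of the root: the derivative is a U (om - T) (2 om - S), with no zero factor as om is
   nonreal. *)
have cd : critdiff a%:C b%:C (u ^+ 2) sg sg != 0.
  have -> : critdiff a%:C b%:C (u ^+ 2) sg sg
      = a%:C * U%:C * (om - T%:C) * (2 * om - S%:C).
    rewrite uE; transitivity (3 * (a%:C * U%:C) * om ^+ 2
      + 2 * (3 * a%:C * U%:C - U%:C) * om + (3 * a%:C * U%:C - U%:C - 1 - b%:C)).
      by rewrite /critdiff /sg; ring.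
    rewrite g2 g1.
    transitivity (a%:C * U%:C * (om - T%:C) * (2 * om - S%:C)
       + a%:C * U%:C * (om ^+ 2 - S%:C * om + P%:C)); first by ring.
    by rewrite omE mulr0 addr0.
  rewrite !mulf_neq0 ?fmorph_eq0 ?(gt_eqF U0) //.
    by rewrite eq_complex /= subr0 [t == 0]gt_eqF // andbF.
  by rewrite mulr_natl mulr2n eq_complex /= subr0 [t + t == 0]gt_eqF ?andbF // addr_gt0.
pose x := - (eta / (u * sg)); pose z := - (eta' / (u * sg)); pose y := - (om / sg).
pose w := om / (sg ^+ 3 * u ^+ 2).
have xz1 : x + z = - sg^-1.
  by rewrite /x /z -opprD -mulrDl etaD; congr (- _); field; rewrite sg0 u0.
have xz2 : x * z = (u ^+ 2 * sg ^+ 2)^-1.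
  rewrite /x /z mulrNN mulrACA etaM mul1r; field; by rewrite sg0 u0.
have e1 : x + y + z = -1.
  rewrite addrAC xz1 /y /sg; have := sg0; rewrite /sg => h; by field.
have e2 : x * y + x * z + y * z = a%:C - b%:C * w.
  have -> : x * y + x * z + y * z = y * (x + z) + x * z by ring.
  rewrite xz1 xz2; apply/eqP; rewrite -subr_eq0.
  have -> : y * - sg^-1 + (u ^+ 2 * sg ^+ 2)^-1 - (a%:C - b%:C * w)
    = - (crit a%:C b%:C (u ^+ 2) sg / (u ^+ 2 * sg ^+ 3)).
    rewrite /y /w /crit /sg; have := sg0; rewrite /sg => h; field; by rewrite h u0.
  by rewrite cr mul0r oppr0.
have e3 : x * y * z = - w.
  rewrite mulrAC xz2 /y /w; field; by rewrite sg0 u0.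
have x0 : x != 0 by rewrite oppr_eq0 !mulf_neq0 ?invr_neq0 ?mulf_neq0.
have y0 : y != 0 by rewrite oppr_eq0 !mulf_neq0 ?invr_neq0.
have xz : x != z.
  rewrite eqr_opp; apply: contra ab_eta => /eqP h; apply/eqP.
  by apply: (mulIf (_ : (u * sg)^-1 != 0)); rewrite ?invr_neq0 ?mulf_neq0.
have ceta : cabs eta' = cabs eta by rewrite !cabsE /= sqrrN.
have czx : cabs z = cabs x by rewrite !cabsN !cabsM ceta.
have ceta1 : cabs eta = 1.
  rewrite cabsE /= rE -[RHS]sqrtr1; congr Num.sqrt.
  by transitivity (su ^+ 2 / 4 + (1 - U / 4)); [field | rewrite suE; ring].
have cu : cabs u = su by rewrite cabsE /= expr0n addr0 sqrtr_sqr gtr0_norm.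
have com : cabs om ^+ 2 = P.
  by rewrite cabsE /= sqr_sqrtr ?addr_ge0 ?sqr_ge0 // tE; field.
have cyx : cabs y < cabs x.
  rewrite !cabsN !cabsM ceta1 mul1r invfM cabsM !cabsV mulrC [ltRHS]mulrC.
  rewrite ltr_pM2l ?invr_gt0 ?cabs_gt0 // cu.
  rewrite -(ltr_pXn2r (n := 2)) ?nnegrE ?cabs_ge0 ?invr_ge0 ?ltW //.
  by rewrite com exprVn suE -[ltRHS]mul1r ltr_pdivlMr // mulrC.
(* Apart from the factor x - z, the difference of the slopes is symmetric in x and z; its vanishing
   would make [critdiff] vanish at the simple root [sg]. *)
have slope : log_slope b%:C x y z != log_slope b%:C z x y.
  have xy : x != y by apply: contraTneq cyx => ->; rewrite ltxx.
  have zy : z != y by apply: contraTneq cyx => <-; rewrite czx ltxx.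
  have z0 : z != 0 by rewrite -cabs_gt0 czx cabs_gt0.
  have zx : z != x by rewrite eq_sym.
  apply: contra cd; rewrite /log_slope eqr_div ?mulf_neq0 ?subr_eq0 //.
  rewrite -subr_eq0.
  have -> : (b%:C * x - 1) * (z * ((z - x) * (z - y)))
      - (b%:C * z - 1) * (x * ((x - y) * (x - z)))
    = - ((x - z) * (b%:C * (x * z) * ((x + z) - 2 * y) - (x + z) ^+ 2 + 2 * (x * z)
       + y * (x + z))) by ring.
  rewrite oppr_eq0 mulf_eq0 subr_eq0 (negPf xz) /= xz1 xz2 => /eqP h.
  apply/eqP/(mulfI sg0); rewrite mulr0 -[RHS](mulr0 (u ^+ 2 * sg ^+ 3)) -h.
  transitivity (sg * critdiff a%:C b%:C (u ^+ 2) sg sg - 3 * crit a%:C b%:C (u ^+ 2) sg).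
    by rewrite cr mulr0 subr0.
  rewrite /critdiff /crit /y /sg; have := sg0; rewrite /sg => h'; field.
  by rewrite h' u0.
(* For real w the conjugate of y would be a root of the same cubic, hence y itself by comparison of
   moduli; but om / (1 + om) is nonreal. *)
have imw : complex.Im w != 0.
  apply: contraL t0 => /eqP iw; rewrite -leNgt le_eqVlt; apply/orP; left.
  have conjw : conjc w = w by case: (w) iw => [rw iw'] /= ->; rewrite oppr0.
  have q v : (v - x) * (v - y) * (v - z) = v ^+ 3 + v ^+ 2 + (a%:C - b%:C * w) * v + w.
    transitivity (v ^+ 3 - (x + y + z) * v ^+ 2 + (x * y + x * z + y * z) * v - x * y * z).
      by ring.
    by rewrite e1 e2 e3; ring.
  have : (conjc y - x) * (conjc y - y) * (conjc y - z) = 0.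
    have qy := q y; rewrite subrr mulr0 mul0r in qy.
    by rewrite q; apply: conj_char_root.
  have ncy : cabs (conjc y) = cabs y by case: (y) => ry iy; rewrite !cabsE /= sqrrN.
  move/eqP; rewrite !mulf_eq0 !subr_eq0 -orbA => /or3P[/eqP h|/eqP h|/eqP h].
  - by move: cyx; rewrite -ncy h ltxx.
  - have : conjc om * sg = om * conjc sg.
      have ys : y * sg = - om by rewrite /y mulNr divfK.
      have ys' : y * conjc sg = - conjc om.
        rewrite -{1}h; have <- : conjc (y * sg) = conjc y * conjc sg by exact: rmorphM.
        by rewrite ys; apply: rmorphN.
      transitivity (- (y * conjc sg) * sg); first by rewrite ys' opprK.
      transitivity (- (y * sg) * conjc sg); first by ring.
      by rewrite ys opprK.
    by move=> /(congr1 (@complex.Im R)) /= h'; apply/eqP; lra.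
  - by move: cyx; rewrite -ncy h czx ltxx.
by exists x, y, z, w; split.
Qed.

End Point.

Lemma map_Qm (R S : comNzRingType) (f : {rmorphism R -> S}) (a b : R) m :
  map_poly f (Qm a b m) = Qm (f a) (f b) m.
Proof.
elim/ltn_ind: m => -[|[|[|m]]] IH.
- by rewrite /Qm /Pm /= rmorph1.
- by rewrite /Qm /Pm /= rmorphN /= map_polyC /= rmorph1.
- rewrite /Qm /Pm /= !(rmorphB, rmorphM) /= !map_polyC /= rmorph1.
  by rewrite map_polyZ map_polyX.
rewrite !QmS3 !(rmorphB, rmorphN, rmorphM) /= map_polyC map_polyZ map_polyX.
by rewrite !IH //; lia.
Qed.

(** * Contradiction with real-rootedness *)

Section Necessity.
Variable R : archiRcfType.
Local Notation C := (complex R).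
Local Notation "x %:C" := (real_complex R x).

Lemma real_rooted_size (p : {poly R}) n : real_rooted p -> (size p <= n.+1)%N ->
  exists (l : R) (s : seq R), p = l *: \prod_(x <- s) ('X - x%:P) /\ (size s <= n)%N.
Proof.
move=> [s hs] sp; have [->|p0] := eqVneq p 0.
  by exists 0, [::]; rewrite scale0r.
exists (lead_coef p), s; split=> //.
by move: sp; rewrite {1}hs size_scale ?lead_coef_eq0 // size_prod_XsubC ltnS.
Qed.

(** Real roots lie at distance at least |Im w| from w, so [laguerre_bound] applies with h = |Im
    w|. *)
Lemma real_rooted_bound (p : {poly R}) (w : C) n : real_rooted p -> (size p <= n.+1)%N ->
  complex.Im w != 0 -> let q := map_poly (real_complex R) p in
  cabs (q^`()^`().[w] * q.[w] - q^`().[w] ^+ 2)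
    <= n%:R * (complex.Im w) ^- 2 * cabs q.[w] ^+ 2.
Proof.
move=> rp sp iw; set q := map_poly _ p => /=; have [l [s [pE sn]]] := real_rooted_size rp sp.
have qE : q = l%:C *: \prod_(x <- [seq x%:C | x <- s]) ('X - x%:P).
  rewrite /q pE map_polyZ rmorph_prod big_map; congr (_ *: _).
  by apply: eq_bigr => x _; exact: map_polyXsubC.
pose h := `|complex.Im w|; have h0 : 0 < h by rewrite normr_gt0.
have hC : 0 < h%:C by rewrite ltcR.
have hall : all (fun x => h%:C <= `|w - x|) [seq x%:C | x <- s].
  apply/allP => _ /mapP[x _ ->]; rewrite normr_cabs lecR.
  by apply: le_trans (Im_le_cabs _); rewrite /h; case: (w) => rw iw' /=; rewrite subr0.
have := laguerre_bound l%:C hC hall; rewrite -qE size_map.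
rewrite !normr_cabs -!rmorphXn -(rmorph_nat (real_complex R)) -!rmorphM lecR => hb.
have h2 : h ^+ 2 = complex.Im w ^+ 2 by rewrite real_normK ?num_real.
have i2 : 0 < complex.Im w ^+ 2 by rewrite -h2 exprn_gt0.
rewrite mulrAC -ler_pdivrMr ?invr_gt0 // invrK -h2; apply: le_trans hb _.
by rewrite ler_wpM2r ?exprn_ge0 ?cabs_ge0 // ler_nat.
Qed.

(** Real-rootedness for all m would force A1 A3 (l1 - l3)^2 = 0 at the point of [equimodular_point],
    where the coefficients are nonzero and the slopes differ. *)
Lemma Qm_not_real_rooted (a b k : R) : 0 <= b -> -1 < k -> k < 3 -> k != 0 ->
  a * k ^+ 3 = k ^+ 2 + b -> ~ (forall m, real_rooted (Qm a b m)).
Proof.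
move=> b0 k1 k3 k0 ak rr.
have [U [T [S [P [U04 SP UP a0 fac]]]]] := crit_nonreal b0 k1 k3 k0 ak.
have [x [y [z [w [[e1 e2 e3] [x0 y0 xz] [czx cyx] slope iw]]]]] :=
  equimodular_point U04 SP UP a0 fac.
have xy : x != y by apply: contraTneq cyx => ->; rewrite ltxx.
have yz : y != z by apply: contraTneq cyx => ->; rewrite czx ltxx.
have z0 : z != 0 by rewrite -cabs_gt0 czx cabs_gt0.
have q0 := Qm_binet e1 e2 e3 xy xz yz.
have [B1 [B2 [B3 [C1 [C2 [C3 [D1 [D2 [D3 hq]]]]]]]]] :=
  Qm_deriv2_binet e1 e2 e3 xy xz yz x0 y0 z0.
have M0 : 0 <= (complex.Im w) ^- 2 by rewrite invr_ge0 sqr_ge0.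
have bound m := real_rooted_bound (rr m)
  (leq_trans (size_Qm a b m) (leq_div m 2 : m %/ 2 < m.+1)%N) iw.
have := equimodular_growth x0 czx cyx M0 q0 (fun m => (hq m).1) (fun m => (hq m).2).
move=> growth; have {growth} /eqP := growth ltac:(by move=> m; have := bound m; rewrite map_Qm).
rewrite mulf_eq0 mulf_eq0 expf_eq0 /= subr_eq0 (negPf slope) orbF.
rewrite /Q_coef !mulf_eq0 !invr_eq0 !mulf_eq0 !subr_eq0.
by rewrite (negPf x0) (negPf z0) (negPf xy) (negPf xz) ![z == _]eq_sym (negPf xz) (negPf yz).
Qed.

End Necessity.

(** * Reduction to the normalised family *)

Section Normalisation.
Variable R : rcfType.

Lemma real_rooted_comp_affine (p : {poly R}) (u v : R) :
  real_rooted p -> real_rooted (p \Po (u%:P + v *: 'X)).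
Proof.
move=> [s ->]; rewrite comp_polyZ -mul_polyC; apply: real_rootedM.
  by apply: real_rooted_size2; rewrite (leq_trans (size_polyC_leq1 _)).
rewrite rmorph_prod /=; elim: s => [|x s IH].
  by rewrite big_nil; apply: real_rooted_size2; rewrite size_poly1.
rewrite big_cons; apply: real_rootedM => //; apply: real_rooted_size2.
rewrite comp_polyB comp_polyX comp_polyC addrAC -polyCB.
apply: leq_trans (size_polyD _ _) _; rewrite geq_max.
rewrite (leq_trans (size_polyC_leq1 _)) //=.
by rewrite (leq_trans (size_scale_leq _ _)) // size_polyX.
Qed.

(** Replacing t by c t in the generating function multiplies the m-th coefficient by c^m. *)
Lemma Pm_normalise (c a b : R) (L : {poly R}) m :
  Pm c (c ^+ 2 *: (a%:P - b *: L)) (c ^+ 3 *: L) m = c ^+ m *: (Qm a b m \Po L).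
Proof.
elim/ltn_ind: m => -[|[|[|m]]] IH.
- by rewrite /Qm /Pm /= expr0 scale1r comp_polyC.
- by rewrite /Qm /Pm /= -!polyCN comp_polyC -mul_polyC -polyCM mulrN mulr1.
- rewrite /Qm /Pm /= !comp_polyB comp_polyM comp_polyC comp_polyZ comp_polyX.
  by rewrite !comp_polyC -!mul_polyC exprS expr1 !polyCM; ring.
rewrite PmS3 QmS3 (IH m.+2) // (IH m.+1) ?ltnS ?leqnSn // (IH m) ?ltnS 1?ltnW //.
rewrite !(comp_polyB, comp_polyM, comp_polyC, comp_polyZ, comp_polyX).
rewrite -!mul_polyC !exprS !polyCM; ring.
Qed.

End Normalisation.

Theorem theorem1 (R : archiRcfType) (c b0 b1 a0 a1 : R)
  (hab : c * a1 * b1 <= 0) (hca : c * a1 != 0) :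
  let B := b0%:P + b1 *: 'X in
  let A := a0%:P + a1 *: 'X in
  let a := b0 / c ^+ 2 - (b1 * a0) / (c ^+ 2 * a1) in
  let b := - (b1 * c) / a1 in
  (forall m : nat, real_rooted (Pm c B A m)) <->
  (0 <= 1 + a + b /\ 0 <= 9 - 27 * a + b).
Proof.
move=> B A a b.
have [c0 a10] : c != 0 /\ a1 != 0 by move: hca; rewrite mulf_eq0 negb_or => /andP[].
(* The sign hypothesis on c a1 b1 amounts to b >= 0. *)
have b_ge0 : 0 <= b.
  have -> : b = - (c * a1 * b1) / a1 ^+ 2 by rewrite /b; field.
  by rewrite divr_ge0 ?sqr_ge0 // oppr_ge0.
(* The substitution is w = A(z) / c^3, and [L'] is its inverse. *)
pose L : {poly R} := (a0 / c ^+ 3)%:P + (a1 / c ^+ 3) *: 'X.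
pose L' : {poly R} := (- (a0 / a1))%:P + (c ^+ 3 / a1) *: 'X.
have PQ m : Pm c B A m = c ^+ m *: (Qm a b m \Po L).
  rewrite -Pm_normalise; congr (Pm c _ _ m).
    rewrite /B /L /a /b; apply/polyP => i.
    rewrite !(coefD, coefB, coefN, coefZ, coefC, coefX).
    by case: i => [|[|i]] /=; field; rewrite ?c0 ?a10.
  rewrite /A /L; apply/polyP => i; rewrite !(coefD, coefZ, coefC, coefX).
  by case: i => [|[|i]] /=; field.
have QP m : Qm a b m = c ^- m *: (Pm c B A m \Po L').
  rewrite PQ comp_polyZ scalerA mulVf ?expf_neq0 // scale1r -comp_polyA.
  suff -> : L \Po L' = 'X by rewrite comp_polyXr.
  rewrite /L comp_polyD comp_polyC comp_polyZ comp_polyX /L'.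
  apply/polyP => i; rewrite !(coefD, coefZ, coefC, coefX).
  by case: i => [|[|i]] /=; field; rewrite ?c0 ?a10.
have scale_rr (k : R) (p : {poly R}) : real_rooted p -> real_rooted (k *: p).
  move=> rp; rewrite -mul_polyC; apply: real_rootedM => //.
  by apply: real_rooted_size2; rewrite (leq_trans (size_polyC_leq1 _)).
have iffQ : (forall m, real_rooted (Pm c B A m)) <-> (forall m, real_rooted (Qm a b m)).
  by split=> h m; [rewrite QP | rewrite PQ]; apply: scale_rr; apply: real_rooted_comp_affine.
split=> [/iffQ rr|[h1 h2]]; last by apply/iffQ => m; apply: Qm_real_rooted.
suff : ~~ ((1 + a + b < 0) || (9 - 27 * a + b < 0)) by rewrite negb_or -!leNgt => /andP[].
apply/negP => /(crossing b_ge0) [k [k1 k3 k0 ak]].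
exact: (Qm_not_real_rooted b_ge0 k1 k3 k0 ak).
Qed.
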